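(* Let $\mathcal{L}$ be the operator $$\mathcal{L}=\frac{1}{V(x)}\sum_{i,j=1}^N\frac{\partial}{\partial x_i}\Big(V(x)\,a_{i,j}(x)\,\frac{\partial}{\partial x_j}\Big),\qquad x\in\mathbb{R}^N,$$ where $V\in C^\infty(\mathbb{R}^N,\mathbb{R})$ is positive, $a_{i,j}\in C^\infty(\mathbb{R}^N,\mathbb{R})$, and the matrix $A(x)=(a_{i,j}(x))_{i,j}$ is symmetric and positive semi-definite for every $x\in\mathbb{R}^N$. Assume that $A(x)\neq 0$ for every $x\in\mathbb{R}^N$. Let $c\in C^\infty(\mathbb{R}^N,\mathbb{R})$ be nonnegative and suppose that the operator $\mathcal{L}_c:=\mathcal{L}-c$ is $C^\infty$-hypoelliptic on every open subset of $\mathbb{R}^N$. Then $\mathcal{L}_c$ satisfies the Weak Maximum Principle on every bounded open set $\Omega\subseteq\mathbb{R}^N$, that is: if $u\in C^2(\Omega,\mathbb{R})$, $\mathcal{L}_c u\geq 0$ on $\Omega$, and $\limsup_{x\to x_0}u(x)\leq 0$ for every $x_0\in\partial\Omega$, then $u\leq 0$ on $\Omega$. As a consequence, if $\Omega\subseteq\mathbb{R}^N$ is bounded (and open), and if $u\in C^2(\Omega)\cap C(\overline{\Omega})$ is nonnegative and such that $\mathcal{L}_c u\geq 0$ on $\Omega$, then $\sup_{\overline{\Omega}}u=\sup_{\partial\Omega}u$.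
   Context: A linear differential operator $L$ with smooth coefficients is $C^\infty$-hypoelliptic in an open set $\Omega\subseteq\mathbb{R}^N$ if, for every distribution $u\in\mathcal{D}'(\Omega)$, every open set $U\subseteq\Omega$ and every $f\in C^\infty(U,\mathbb{R})$, the equation $Lu=f$ in $U$ (in the sense of distributions) implies that $u$ is (a function-type distribution associated with) a $C^\infty$ function on $U$. The operator $\mathcal{L}-c$ acts as $u\mapsto\mathcal{L}u-c\,u$. *)

(* Defs.v *)
From HB Require Import structures.
From mathcomp Require Import all_boot all_order all_algebra.
From mathcomp Require Import all_classical all_reals all_analysis.

Set Implicit Arguments.
Unset Strict Implicit.
Unset Printing Implicit Defensive.

Import Order.TTheory GRing.Theory Num.Theory.
Import numFieldNormedType.Exports.

Local Open Scope classical_set_scope.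
Local Open Scope ring_scope.

(* Points of R^N are row vectors. A function on an open subset of R^N is
   represented by a total function; its values off that subset play no role. *)

Definition boundary {T : topologicalType} (A : set T) : set T :=
  closure A `&` closure (~` A).

Section calculus.
Context {R : realType} {N : nat}.
Implicit Types (f g phi : 'rV[R]_N -> R) (U K : set 'rV[R]_N).

Definition partial (i : 'I_N) f : 'rV[R]_N -> R := 'D_(delta_mx 0 i) f.

(* Iterated partial derivatives are indexed by words rather than multi-indices,
   so no symmetry of mixed derivatives is presupposed. *)
Definition partials (s : seq 'I_N) f : 'rV[R]_N -> R := foldr partial f s.

(* C^k(U), intended for open U *)
Definition Ck (k : nat) U f : Prop :=
  (forall s : seq 'I_N, (size s <= k)%N ->
     forall x, U x -> {for x, continuous (partials s f)}) /\
  (forall (s : seq 'I_N) (i : 'I_N), (size s < k)%N ->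
     forall x, U x -> derivable (partials s f) x (delta_mx 0 i)).

Definition smooth U f : Prop := forall k, Ck k U f.

Definition supp f : set 'rV[R]_N := closure [set x | f x != 0].

Definition test_function U phi : Prop :=
  [/\ smooth setT phi, compact (supp phi) & supp phi `<=` U].

(* the supremum of |d^s phi| over R^N and over all words s of length <= k *)
Definition Ck_norm (k : nat) phi : R :=
  sup [set `|partials s phi x| |
        s in [set s : seq 'I_N | (size s <= k)%N] & x in [set: 'rV[R]_N]].

End calculus.

(* The integral over R^N, as an N-fold iterated one-dimensional Lebesgue
   integral (coordinate 0 outermost). It is only applied to continuous compactly
   supported functions, where by Fubini's theorem it is the integral against
   N-dimensional Lebesgue measure. *)
Fixpoint integral_rV {R : realType} (N : nat) : ('rV[R]_N -> R) -> R :=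
  match N return ('rV[R]_N -> R) -> R with
  | 0 => fun f => f 0
  | N'.+1 => fun f =>
      \int[lebesgue_measure]_t
        integral_rV (fun y : 'rV[R]_N' => f (row_mx (t%:M : 'rV[R]_1) y))
  end.

Section distributions.
Context {R : realType} {N : nat}.
Implicit Types (f g phi psi : 'rV[R]_N -> R) (U K Omega : set 'rV[R]_N).

(* A distribution on Omega is a functional whose values matter only on the test
   functions on Omega. *)
Definition functional : Type := ('rV[R]_N -> R) -> R.
Implicit Types T : functional.

Definition distribution_on Omega T : Prop :=
  (forall (a : R) phi psi, test_function Omega phi -> test_function Omega psi ->
     T (fun x => a * phi x + psi x) = a * T phi + T psi) /\
  (forall K, compact K -> K `<=` Omega ->
     exists (k : nat) (C : R), forall phi,
       test_function Omega phi -> supp phi `<=` K -> `|T phi| <= C * Ck_norm k phi).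

Definition dist_of f : functional := fun phi => integral_rV (fun x => f x * phi x).

Definition eq_dist U (T1 T2 : functional) : Prop :=
  forall phi, test_function U phi -> T1 phi = T2 phi.

Definition dist_mul g T : functional := fun phi => T (fun x => g x * phi x).

Definition dist_partial (i : 'I_N) T : functional :=
  fun phi => - T (partial i phi).

(* P is the action on distributions of a linear differential operator with
   smooth coefficients. *)
Definition hypoelliptic (P : functional -> functional) Omega : Prop :=
  forall T, distribution_on Omega T ->
  forall U, open U -> U `<=` Omega ->
  forall f, smooth U f -> eq_dist U (P T) (dist_of f) ->
  exists g, smooth U g /\ eq_dist U T (dist_of g).

End distributions.

Section operator.
Context {R : realType} {N : nat}.
Variables (V : 'rV[R]_N -> R) (A : 'rV[R]_N -> 'M[R]_N) (c : 'rV[R]_N -> R).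

Definition Lop (u : 'rV[R]_N -> R) : 'rV[R]_N -> R := fun x =>
  (V x)^-1 * \sum_(i < N) \sum_(j < N)
    partial i (fun y => V y * A y i j * partial j u y) x.

Definition Lc (u : 'rV[R]_N -> R) : 'rV[R]_N -> R :=
  fun x => Lop u x - c x * u x.

Definition dist_Lop (T : functional) : functional :=
  dist_mul (fun x => (V x)^-1) (fun phi : 'rV[R]_N -> R =>
    \sum_(i < N) \sum_(j < N)
      dist_partial i (dist_mul (fun y => V y * A y i j) (dist_partial j T)) phi).

Definition dist_Lc (T : functional) : functional :=
  fun phi : 'rV[R]_N -> R => dist_Lop T phi - dist_mul c T phi.

End operator.

(* In the limsup, x tends to x0 within Omega. *)
Definition weak_max_principle {R : realType} {N : nat}
    (P : ('rV[R]_N -> R) -> 'rV[R]_N -> R) (Omega : set 'rV[R]_N) : Prop :=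
  forall u : 'rV[R]_N -> R,
    Ck 2 Omega u ->
    (forall x, Omega x -> 0 <= P u x) ->
    (forall x0, boundary Omega x0 ->
       (limf_esup (fun x => (u x)%:E) (within Omega (nbhs x0)) <= 0)%E) ->
    forall x, Omega x -> u x <= 0.

(* Main.v *)
Require Import Defs.
From HB Require Import structures.
From mathcomp Require Import all_boot all_order all_algebra.
From mathcomp Require Import all_classical all_reals all_analysis.
From mathcomp Require Import ring lra.
Import Order.TTheory GRing.Theory Num.Theory.
Import numFieldNormedType.Exports.
Local Open Scope classical_set_scope.
Local Open Scope ring_scope.

(** Suppose that a subsolution u on a bounded open set Omega, with limsup at most
    zero at the boundary, is positive somewhere. For s > 0 the set
    superlevel s = {u >= s} is then a compact subset of Omega, so that the
    truncation w = (u - s)_+^2, extended by zero, is a C^1 function with compact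
    support on the whole space.

    The operator is a divergence: V L u = sum_i d_i F_i, where the flux is
    F = V A grad u. Hence sum_i d_i (w F_i) has integral zero. But it is equal to
      w V L u + 2 (u - s)_+ V <A grad u, grad u>,
    and both terms are nonnegative because L u >= c u >= 0 wherever w > 0. So
    both vanish, and letting s vary gives A grad u = 0 and c = 0 on {u > 0}
    (degenerate_where_positive).

    Once A grad u = 0 on {u > 0}, any function of u that vanishes for u <= s is a
    weak solution: the distribution w satisfies (L - c) w = 0 for every s > 0
    (dist_Lc_sqtrunc), smooth or not. Hypoellipticity then forces w to be smooth
    (sqtrunc_smooth). However w is not C^2 for a suitable s. Indeed, the
    derivative d_i w = 2 (u - s)_+ d_i u has a corner at every point where
    d_i u <> 0 and u = s > 0 (smooth_truncation_critical), and such points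
    exist: on a line in direction e_i through a point where u > 0, the
    truncation goes from a positive value to zero (exists_noncritical).

    The rest is the calculus that this argument uses. Integration over R^N is
    needed only for continuous functions with compact support, on which the
    iterated integral is linear, continuous for uniform convergence with bounded
    supports, strictly positive and translation invariant. Translation
    invariance yields that partial derivatives have integral zero
    (integral_rV_partial) without any interchange of integrals. The passage from
    distributions back to functions (fundamental_lemma) requires test functions,
    built from exp(-1/t).

    The equality of suprema follows on applying the principle to u minus its
    supremum over the boundary, a nonnegative constant. *)

(** * Compactly supported continuous functions on the line *)

(** The class C_c. The support condition is stated with a radius, because the
    estimates of integrals below are in terms of it. *)
Definition cc {R : realType} {V : normedModType R} (f : V -> R) : Prop :=
  continuous f /\ exists L : R, forall x, L < `|x| -> f x = 0.

Section cc_line.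
Context {R : realType}.
Notation mu := (@lebesgue_measure R).
Implicit Type f : R -> R.

Lemma restrict_support f L : (forall t, L < `|t| -> f t = 0) ->
  f = f \_ `[- L, L].
Proof.
move=> fL; apply/funext => t; rewrite patchE.
case: ifPn => // /negP tL; apply: fL; rewrite ltNge; apply/negP => tL'.
by apply: tL; rewrite inE/= in_itv/= -ler_norml.
Qed.

Lemma cc_integrable f : cc f -> mu.-integrable setT (EFin \o f).
Proof.
move=> [cf [L fL]].
rewrite (restrict_support _ _ fL) -restrict_EFin -integrable_mkcond//.
by apply: continuous_compact_integrable;
  [exact: segment_compact|exact: continuous_subspaceT].
Qed.

Lemma cc_Rintegral_segment f L : (forall t, L < `|t| -> f t = 0) ->
  \int[mu]_t f t = \int[mu]_(t in `[- L, L]) f t.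
Proof. by move=> fL; rewrite [RHS]Rintegral_mkcond -restrict_support. Qed.

Lemma fine_lebesgue_itv (a b : R) : a <= b -> fine (mu `[a, b]%classic) = b - a.
Proof.
move=> ab; rewrite lebesgue_measure_itv/= lte_fin; case: ltrP => //= ba.
have -> : a = b by apply/le_anti/andP.
  by rewrite subrr.
Qed.

Lemma norm_Rintegral_le f L e : cc f -> 0 <= L ->
  (forall t, L < `|t| -> f t = 0) -> (forall t, `|f t| <= e) ->
  `|\int[mu]_t f t| <= e * (2 * L).
Proof.
move=> ccf L0 fL fe.
have mL : measurable (`[- L, L]%classic : set (measurableTypeR R)).
  exact: measurable_itv.
have fi : mu.-integrable `[- L, L] (EFin \o f).
  by apply: integrableS (cc_integrable _ ccf).
rewrite (cc_Rintegral_segment _ _ fL).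
apply: (le_trans (le_normr_Rintegral mL fi)).
have -> : e * (2 * L) = \int[mu]_(t in `[- L, L]) e.
  rewrite Rintegral_cst// fine_lebesgue_itv; last lra.
  by congr (_ * _); lra.
apply: le_Rintegral => //; first exact: (integrable_norm fi).
by apply: continuous_compact_integrable;
  [exact: segment_compact|apply: continuous_subspaceT => x; exact: cvg_cst].
Qed.

(** Change of variables on a segment that contains the supports of f and of its
    translate. *)
Lemma Rintegral_shift f (h : R) : cc f ->
  \int[mu]_t f (t + h) = \int[mu]_t f t.
Proof.
move=> [cf [L fL]].
(* A radius M for which [- M, M] contains the support of the translate. *)
set M := `|L| + `|h|.
have M0 : 0 <= M by rewrite addr_ge0.
have LM : L <= M by rewrite (le_trans (ler_norm _))// lerDl.
have hM t : M < `|t| -> f (t + h) = 0.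
  move=> Mt; apply: fL; rewrite (le_lt_trans (ler_norm _))//.
  have := lerB_dist t (- h); rewrite normrN opprK; rewrite /M in Mt; lra.
rewrite (cc_Rintegral_segment (fun t => f (t + h)) _ hM).
have fE : f = f \_ `[- M + h, M + h].
  apply/funext => t; rewrite patchE; case: ifPn => // /negP tM.
  apply: fL; rewrite ltNge; apply/negP => tL; apply: tM.
  rewrite inE/= in_itv/=; move: tL => /(le_trans)/(_ (ler_norm L)).
  rewrite /M ler_norml; have := ler_norm h; have := ler_norm (- h).
  by rewrite normrN => ? ? /andP[? ?]; apply/andP; split; lra.
have -> : \int[mu]_t f t = \int[mu]_(t in `[- M + h, M + h]) f t.
  by rewrite [RHS]Rintegral_mkcond -fE.
congr fine.
have dsh : (shift h : R -> R)^`()%classic = cst 1.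
  apply/funext => x; rewrite derive1E.
  exact: (@derive_val _ _ _ _ _ (shift h) _ (is_derive_shift _ _ _)).
have csh : continuous (shift h : R -> R).
  by move=> x; apply: cvgD; [exact: cvg_id|exact: cvg_cst].
rewrite -[_ + h in RHS]/(shift h (- M)) -[M + h]/(shift h M).
rewrite (@integration_by_substitution_increasing _ (shift h)).
- by apply: eq_integral => t _; rewrite fctE dsh/= mulr1.
- by rewrite /=; lra.
- by move=> x y _ _; rewrite /= ltrD2r.
- by move=> x _; rewrite dsh; exact: cvg_cst.
- by rewrite dsh; exact: is_cvg_cst.
- by rewrite dsh; exact: is_cvg_cst.
- by split; [move=> *; exact: ex_derive|exact/cvg_at_right_filter/csh
    |exact/cvg_at_left_filter/csh].
- exact: continuous_subspaceT.
Qed.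

Lemma Rintegral_gt0 f t0 : cc f -> (forall t, 0 <= f t) -> 0 < f t0 ->
  0 < \int[mu]_t f t.
Proof.
move=> ccf f0 ft0.
have [r r0 fr] : exists2 r : R, 0 < r & forall t, t \in `[t0 - r, t0 + r] -> f t0 / 2 <= f t.
  have : \forall t \near t0, f t0 / 2 < f t.
    by apply: (cvgr_gt (f t0) (ccf.1 t0)); lra.
  move=> /nbhs_ballP[r /= r0 rf]; exists (r / 2); first by rewrite divr_gt0.
  move=> t; rewrite in_itv/= => tr; apply/ltW/rf.
  rewrite /ball/= ltr_norml; apply/andP; split; lra.
have mD : measurable (`[t0 - r, t0 + r]%classic : set (measurableTypeR R)).
  exact: measurable_itv.
have : \int[mu]_(t in `[t0 - r, t0 + r]) (f t0 / 2) <= \int[mu]_t f t.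
  rewrite Rintegral_mkcond; apply: le_Rintegral => //.
  - rewrite -restrict_EFin -integrable_mkcond//.
    by apply: continuous_compact_integrable;
      [exact: segment_compact|apply: continuous_subspaceT => x; exact: cvg_cst].
  - exact: cc_integrable.
  - move=> t _; rewrite patchE; case: ifPn => // /[1!inE]; exact: fr.
rewrite Rintegral_cst// fine_lebesgue_itv; last lra.
by apply: lt_le_trans; rewrite mulr_gt0//; lra.
Qed.

End cc_line.

(** * Compactly supported continuous functions on a normed space and on R^N *)

Section cc_theory.
Context {R : realType}.

Lemma continuous_epsP {V : normedModType R} (f : V -> R) (x : V) :
  {for x, continuous f} <->
  forall e, 0 < e -> exists2 d : R, 0 < d &
    forall y, `|x - y| < d -> `|f x - f y| < e.
Proof.
split=> [/cvgrPdist_lt fx e e0|fx].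
  by have /nbhs_normP[d /= d0 df] := fx e e0; exists d.
apply/cvgrPdist_lt => e e0; apply/nbhs_normP.
by have [d d0 df] := fx e e0; exists d.
Qed.

Lemma lipschitz1_continuous {V W : normedModType R} (g : V -> W) :
  (forall x y, `|g x - g y| <= `|x - y|) -> continuous g.
Proof.
move=> gL x; apply/cvgrPdist_lt => e e0; apply/nbhs_normP; exists e => //= y.
exact: le_lt_trans.
Qed.

Section algebra.
Context {V : normedModType R}.
Implicit Types f g : V -> R.

Lemma ccZD (a : R) f g : cc f -> cc g -> cc (fun x => a * f x + g x).
Proof.
move=> [cf [L fL]] [cg [M gM]]; split.
  by move=> x; apply: cvgD; [apply: cvgM; [exact: cvg_cst|exact: cf]|exact: cg].
exists (Num.max L M) => x; rewrite gt_max => /andP[Lx Mx].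
by rewrite fL// gM// mulr0 addr0.
Qed.

Lemma ccMl f g : continuous f -> cc g -> cc (fun x => f x * g x).
Proof.
move=> cf [cg [M gM]]; split; first by move=> x; apply: cvgM; [exact: cf|exact: cg].
by exists M => x Mx; rewrite gM// mulr0.
Qed.

Lemma cc0 : cc (fun _ : V => 0 : R).
Proof. by split; [move=> x; exact: cvg_cst|exists 0]. Qed.

Lemma ccZ (a : R) f : cc f -> cc (fun x => a * f x).
Proof. by apply: ccMl => x; exact: cvg_cst. Qed.

Lemma ccD f g : cc f -> cc g -> cc (fun x => f x + g x).
Proof.
move=> cf cg; have := ccZD 1 f g cf cg.
by congr cc; apply/funext => x; rewrite mul1r.
Qed.

Lemma ccN f : cc f -> cc (fun x => - f x).
Proof.
move=> /(ccZ (-1)); congr cc; by apply/funext => x; rewrite mulN1r.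
Qed.

Lemma ccB f g : cc f -> cc g -> cc (fun x => f x - g x).
Proof. by move=> cf cg; apply: ccD => //; exact: ccN. Qed.

Lemma cc_sum (I : Type) (r : seq I) (F : I -> V -> R) :
  (forall i, cc (F i)) -> cc (fun x => \sum_(i <- r) F i x).
Proof.
move=> cF; elim: r => [|i r IH].
  by have := cc0; congr cc; apply/funext => x; rewrite big_nil.
have := ccD _ _ (cF i) IH; congr cc; by apply/funext => x; rewrite big_cons.
Qed.

Lemma cc_shift (a : V) f : cc f -> cc (fun x => f (x + a)).
Proof.
move=> [cf [L fL]]; split.
  move=> x; apply: (@continuous_comp _ _ _ (fun z => z + a) f); last exact: cf.
  by apply: cvgD; [exact: cvg_id|exact: cvg_cst].
exists (L + `|a|) => x Lx; apply: fL.
by have := lerB_dist x (- a); rewrite normrN opprK; lra.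
Qed.

End algebra.

Section rows.
Context {N : nat}.
Implicit Types f g : 'rV[R]_N -> R.

Lemma rV_norm_le (x : 'rV[R]_N) (M : R) :
  0 <= M -> (forall j, `|x 0 j| <= M) -> `|x| <= M.
Proof.
move=> M0 xM; rewrite [leLHS]/Num.norm/= mx_normrE; apply/bigmax_leP; split=> //.
by move=> [i j] _ /=; rewrite ord1.
Qed.

Lemma rV_coord_le (x : 'rV[R]_N) j : `|x 0 j| <= `|x|.
Proof.
rewrite [leRHS]/Num.norm/= mx_normrE; apply/bigmax_geP; right.
by exists (0, j).
Qed.

Lemma rV_ball_compact (L : R) : compact [set x : 'rV[R]_N | `|x| <= L].
Proof.
apply: bounded_closed_compact.
  by exists L; split; rewrite ?num_real// => M LM x /= xL; rewrite (le_trans xL)// ltW.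
rewrite (_ : [set _ | _] = (fun x : 'rV[R]_N => `|x|) @^-1` [set y | y <= L])//.
apply: preimage_closed; last exact: closed_le.
by move=> x _; exact: norm_continuous.
Qed.

Lemma cc_bounded f : cc f -> exists2 M, 0 <= M & forall x, `|f x| <= M.
Proof.
move=> [cf [L fL]].
have /compact_bounded[M [_ /(_ (`|M| + 1))]] :=
  continuous_compact (continuous_subspaceT cf) (rV_ball_compact L).
rewrite ltr_pwDr//; last exact: ler_norm.
move=> /(_ erefl) fM; exists (`|M| + 1); first by rewrite addr_ge0.
move=> x; have [xL|xL] := lerP `|x| L; first by apply: fM; exists x.
by rewrite fL// normr0 addr_ge0.
Qed.

(** Heine-Cantor on the ball that contains the support. If both points are
    outside this ball there is nothing to prove, and otherwise the estimate is
    symmetric in the two points. *)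
Lemma cc_unif_continuous f : cc f ->
  forall e, 0 < e -> exists2 d : R, 0 < d &
    forall x y, `|x - y| < d -> `|f x - f y| < e.
Proof.
move=> [cf [L fL]] e e0.
have /compact_near_coveringP ncK := rV_ball_compact L.
have /= [] := ncK R (0^'+) (fun d x => forall y, `|x - y| < d -> `|f x - f y| < e).
  move=> x _; have [r r0 rf] := (continuous_epsP f x).1 (cf x) _ (divr_gt0 e0 (ltr0Sn R 1)).
  have r20 : 0 < r / 2 by rewrite divr_gt0.
  exists (ball x (r / 2), [set d | d < r / 2]).
    by split; [exact: nbhsx_ballx|exact: nbhs_right_lt].
  move=> [z d]/= [xz dr] y zy.
  have fxz : `|f x - f z| < e / 2.
    apply: rf; move: xz; rewrite -ball_normE/= => xz.
    by rewrite (lt_trans xz)//; lra.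
  have fxy : `|f x - f y| < e / 2.
    apply: rf; move: xz; rewrite -ball_normE/= => xz.
    have := ler_distD z x y; lra.
  have := ler_distD (f x) (f z) (f y); rewrite (distrC (f z) (f x)); lra.
move=> d /= d0 dK; exists (d / 2); first by rewrite divr_gt0.
have dK2 x y : `|x| <= L -> `|x - y| < d / 2 -> `|f x - f y| < e.
  move=> xL; apply: (dK (d / 2)) => //=; last by rewrite divr_gt0.
  by rewrite sub0r normrN gtr0_norm ?divr_gt0//; lra.
move=> x y xy; have [xL|xL] := lerP `|x| L; first exact: dK2.
have [yL|yL] := lerP `|y| L; first by rewrite distrC; apply: dK2 => //; rewrite distrC.
by rewrite !fL// subrr normr0.
Qed.

End rows.

Section slices.
Context {N : nat}.

(** Points of R^(N+1) as the definition of integral_rV decomposes them. *)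
Definition cons_rV (t : R) (y : 'rV[R]_N) : 'rV[R]_N.+1 :=
  row_mx (t%:M : 'rV[R]_1) y.

Lemma cons_rV0 t y : cons_rV t y 0 0 = t.
Proof.
transitivity (row_mx (t%:M : 'rV[R]_1) y 0 (lshift N 0)).
  by rewrite /cons_rV; congr (row_mx _ _ _ _); exact/val_inj.
by rewrite row_mxEl mxE eqxx mulr1n.
Qed.

Lemma cons_rVS t y j : cons_rV t y 0 (lift 0 j) = y 0 j.
Proof.
rewrite -(row_mxEr (t%:M : 'rV[R]_1) y).
by rewrite /cons_rV; congr (row_mx _ _ _ _); exact/val_inj.
Qed.

Lemma cons_rVP (x y : 'rV[R]_N.+1) :
  x 0 0 = y 0 0 -> (forall j, x 0 (lift 0 j) = y 0 (lift 0 j)) -> x = y.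
Proof. by move=> xy0 xyS; apply/rowP => j; have [k ->|->] := unliftP 0 j. Qed.

Lemma cons_rVB t y t' y' :
  cons_rV t y - cons_rV t' y' = cons_rV (t - t') (y - y').
Proof. by apply: cons_rVP => [|j]; rewrite mxE [X in _ + X]mxE !(cons_rV0, cons_rVS) ?mxE. Qed.

Lemma cons_rVD t y t' y' :
  cons_rV t y + cons_rV t' y' = cons_rV (t + t') (y + y').
Proof. by apply: cons_rVP => [|j]; rewrite mxE !(cons_rV0, cons_rVS) ?mxE. Qed.

Lemma cons_rVE (x : 'rV[R]_N.+1) : x = cons_rV (x 0 0) (\row_j x 0 (lift 0 j)).
Proof.
by apply: cons_rVP => [|j]; rewrite ?cons_rV0// cons_rVS mxE.
Qed.

Lemma norm_cons_rV_head t y : `|t| <= `|cons_rV t y|.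
Proof. by rewrite -{1}(cons_rV0 t y) rV_coord_le. Qed.

Lemma norm_cons_rV_tail t y : `|y| <= `|cons_rV t y|.
Proof. by apply: rV_norm_le => // j; rewrite -(cons_rVS t y) rV_coord_le. Qed.

Lemma norm_cons_rV_le t y : `|cons_rV t y| <= Num.max `|t| `|y|.
Proof.
apply: rV_norm_le => [|j]; first by rewrite le_max normr_ge0.
have [k ->|->] := unliftP 0 j; last by rewrite cons_rV0 le_max lexx.
by rewrite cons_rVS le_max rV_coord_le orbT.
Qed.

Lemma cc_slice (f : 'rV[R]_N.+1 -> R) t : cc f -> cc (fun y => f (cons_rV t y)).
Proof.
move=> [cf [L fL]]; split.
  move=> y; apply: (@continuous_comp _ _ _ (cons_rV t) f); last exact: cf.
  apply: lipschitz1_continuous => {}y y'; rewrite cons_rVB subrr.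
  by rewrite (le_trans (norm_cons_rV_le _ _))// normr0 ge_max normr_ge0 lexx.
by exists L => y Ly; apply: fL; exact: lt_le_trans (norm_cons_rV_tail _ _).
Qed.

End slices.

End cc_theory.

(** * The iterated integral on compactly supported continuous functions *)

Section integral_rV_theory.
Context {R : realType}.
Notation mu := (@lebesgue_measure R).
Notation I f := (integral_rV f).

Definition integral_tail {N} (f : 'rV[R]_N.+1 -> R) (t : R) : R :=
  I (fun y => f (cons_rV t y)).

Lemma integral_rVS N (f : 'rV[R]_N.+1 -> R) :
  I f = \int[mu]_t integral_tail f t.
Proof. by []. Qed.

(** Linearity and boundedness are the statement of one induction on the
    dimension: both are needed in dimension N for the inner integral to be a
    continuous function of the outer variable, without which the outer integral
    could not be shown to be linear. *)
Definition integral_linear_bounded N : Prop :=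
  (forall a (f g : 'rV[R]_N -> R), cc f -> cc g ->
     I (fun x => a * f x + g x) = a * I f + I g) /\
  (forall (f : 'rV[R]_N -> R) L e, cc f -> 0 <= L ->
     (forall x, L < `|x| -> f x = 0) -> (forall x, `|f x| <= e) ->
     `|I f| <= e * (2 * L) ^+ N).

(** Two slices of f are uniformly close by uniform continuity of f, and their
    integrals differ by the integral of the difference of the slices. *)
Lemma cc_integral_tail N : integral_linear_bounded N ->
  forall f : 'rV[R]_N.+1 -> R, cc f -> cc (integral_tail f).
Proof.
move=> [lin bnd] f ccf; have [cf [L fL]] := ccf.
have L'fL t x : L < `|t| -> f (cons_rV t x) = 0.
  by move=> Lt; apply: fL; exact: lt_le_trans (norm_cons_rV_head _ _).
have I0 : I (fun _ : 'rV[R]_N => 0 : R) = 0.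
  have := lin 1 _ _ cc0 cc0; under eq_fun do rewrite mulr0 addr0.
  by rewrite mul1r => /eqP; rewrite -subr_eq0 opprD addNKr oppr_eq0 => /eqP.
split; last first.
  exists L => t Lt; rewrite /integral_tail -[RHS]I0; congr integral_rV.
  by apply/funext => y; exact: L'fL.
move=> t; apply/continuous_epsP => e e0.
set C := (2 * `|L|) ^+ N + 1.
have C0 : 0 < C by rewrite ltr_wpDl// exprn_ge0// mulr_ge0.
have [d d0 fd] := cc_unif_continuous f ccf _ (divr_gt0 e0 C0).
exists d => // s ts.
have -> : integral_tail f t - integral_tail f s =
    I (fun y => -1 * f (cons_rV s y) + f (cons_rV t y)).
  by rewrite lin ?mulN1r 1?addrC//; exact: cc_slice.
apply: (@le_lt_trans _ _ (e / C * (2 * `|L|) ^+ N)).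
  apply: bnd => //.
  - by apply: ccZD; exact: cc_slice.
  - move=> y Ly; have {}Ly : L < `|y| by rewrite (le_lt_trans _ Ly)// ler_norm.
    by rewrite !fL ?mulr0 ?addr0//; exact: lt_le_trans (norm_cons_rV_tail _ _).
  - move=> y; rewrite mulN1r addrC; apply/ltW/fd; rewrite cons_rVB subrr.
    rewrite (le_lt_trans (norm_cons_rV_le _ _))// normr0 maxEge normr_ge0.
    exact: ts.
by rewrite mulrAC ltr_pdivrMr// ltr_pM2l// /C ltrDl.
Qed.

Lemma integral_rV_linear_bounded N : integral_linear_bounded N.
Proof.
elim: N => [|N IH]; first by split => [//|f L e _ _ _ fe]; rewrite expr0 mulr1; exact: fe.
have [lin bnd] := IH; have ccT := cc_integral_tail N IH.
split=> [a f g cf cg|f L e ccf L0 fL fe].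
  rewrite !integral_rVS -RintegralZl//; last exact/cc_integrable/ccT.
  rewrite -RintegralD//; last 2 first.
  - exact/cc_integrable/ccZ/ccT.
  - exact/cc_integrable/ccT.
  congr (Rintegral _ _ _); apply/funext => t.
  by rewrite /integral_tail lin//; exact: cc_slice.
rewrite integral_rVS exprSr mulrA; apply: norm_Rintegral_le => //.
- exact: ccT.
- move=> t Lt; apply/eqP; rewrite -normr_le0.
  rewrite -[leRHS](mul0r ((2 * L) ^+ N)); apply: bnd => //; first exact: cc_slice.
    by move=> x Lx; apply: fL; exact: lt_le_trans (norm_cons_rV_head _ _).
  move=> x; rewrite fL ?normr0//; exact: lt_le_trans (norm_cons_rV_head _ _).
- move=> t; apply: bnd => //; first exact: cc_slice.
  by move=> x Lx; apply: fL; exact: lt_le_trans (norm_cons_rV_tail _ _).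
Qed.

Section fixed_dimension.
Context {N : nat}.
Implicit Types f g : 'rV[R]_N -> R.

Lemma integral_rVZD a f g : cc f -> cc g ->
  I (fun x => a * f x + g x) = a * I f + I g.
Proof. exact: (integral_rV_linear_bounded N).1. Qed.

Lemma norm_integral_rV_le f L e : cc f -> 0 <= L ->
  (forall x, L < `|x| -> f x = 0) -> (forall x, `|f x| <= e) ->
  `|I f| <= e * (2 * L) ^+ N.
Proof. exact: (integral_rV_linear_bounded N).2. Qed.

Lemma integral_rV0 : I (fun _ : 'rV[R]_N => 0) = 0.
Proof.
have := integral_rVZD 1 _ _ cc0 cc0; under eq_fun do rewrite mulr0 addr0.
by rewrite mul1r => /eqP; rewrite -subr_eq0 opprD addNKr oppr_eq0 => /eqP.
Qed.

Lemma integral_rVD f g : cc f -> cc g -> I (fun x => f x + g x) = I f + I g.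
Proof.
move=> cf cg; rewrite -[I f]mul1r -integral_rVZD//; congr integral_rV.
by apply/funext => x; rewrite mul1r.
Qed.

Lemma integral_rVZ a f : cc f -> I (fun x => a * f x) = a * I f.
Proof.
move=> cf; rewrite -[RHS]addr0 -integral_rV0 -integral_rVZD//; last exact: cc0.
by congr integral_rV; apply/funext => x; rewrite addr0.
Qed.

Lemma integral_rVN f : cc f -> I (fun x => - f x) = - I f.
Proof.
move=> cf; rewrite -mulN1r -integral_rVZ//; congr integral_rV.
by apply/funext => x; rewrite mulN1r.
Qed.

Lemma integral_rVB f g : cc f -> cc g -> I (fun x => f x - g x) = I f - I g.
Proof. by move=> cf cg; rewrite integral_rVD ?integral_rVN//; exact: ccN. Qed.

Lemma integral_rV_sum (J : Type) (r : seq J) (F : J -> 'rV[R]_N -> R) :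
  (forall j, cc (F j)) ->
  I (fun x => \sum_(j <- r) F j x) = \sum_(j <- r) I (F j).
Proof.
move=> cF; elim: r => [|j r IH].
  rewrite big_nil -[RHS]integral_rV0; congr integral_rV.
  by apply/funext => x; rewrite big_nil.
rewrite big_cons -IH -integral_rVD//; last exact: cc_sum.
by congr integral_rV; apply/funext => x; rewrite big_cons.
Qed.

End fixed_dimension.

Lemma integral_rV_shift N (f : 'rV[R]_N -> R) (a : 'rV[R]_N) : cc f ->
  I (fun x => f (x + a)) = I f.
Proof.
elim: N f a => [|N IH] f a ccf.
  by rewrite /=; congr f; apply/rowP => -[].
have ccT := cc_integral_tail N (integral_rV_linear_bounded N).
rewrite !integral_rVS -(Rintegral_shift (integral_tail f) (a 0 0)); last exact: ccT.
congr (Rintegral _ _ _); apply/funext => t.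
rewrite /integral_tail -[RHS](IH _ (\row_j a 0 (lift 0 j))); last exact: cc_slice.
congr integral_rV; apply/funext => y.
by rewrite [in LHS](cons_rVE a) cons_rVD.
Qed.

Lemma integral_rV_ge0 N (f : 'rV[R]_N -> R) : (forall x, 0 <= f x) -> 0 <= I f.
Proof.
elim: N f => [|N IH] f f0; first exact: f0.
by rewrite integral_rVS; apply: Rintegral_ge0 => t _; exact: IH.
Qed.

(** On each line the inner integral is a nonnegative continuous function of the
    outer variable, positive at the outer coordinate of x0 by induction. *)
Lemma integral_rV_gt0 N (f : 'rV[R]_N -> R) x0 : cc f ->
  (forall x, 0 <= f x) -> 0 < f x0 -> 0 < I f.
Proof.
elim: N f x0 => [|N IH] f x0 ccf f0 fx0.
  by rewrite /= (_ : (0 : 'rV[R]_0) = x0)//; apply/rowP => -[].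
rewrite integral_rVS; apply: (Rintegral_gt0 _ (x0 0 0)).
- exact/cc_integral_tail/ccf/integral_rV_linear_bounded.
- by move=> t; exact: integral_rV_ge0.
- apply: (IH _ (\row_j x0 0 (lift 0 j))) => //; first exact: cc_slice.
  by rewrite -cons_rVE.
Qed.

Lemma integral_rV_eq0 N (f : 'rV[R]_N -> R) : cc f ->
  (forall x, 0 <= f x) -> I f = 0 -> forall x, f x = 0.
Proof.
move=> ccf f0 If0 x; apply/eqP; rewrite eq_le f0 andbT leNgt; apply/negP => fx.
by have := integral_rV_gt0 N f x ccf f0 fx; rewrite If0 ltxx.
Qed.

End integral_rV_theory.

(** * Directional derivatives and the classes C^k *)

Section directional.
Context {R : realType} {V : normedModType R}.
Implicit Types (f : V -> R) (x v : V).

Lemma line_growth_rate f x v (t : R) :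
  (fun h : R => h^-1 *: (((fun s : R => f (s *: v + x)) \o shift t) (h *: 1) -
                     f (t *: v + x))) =
  (fun h : R => h^-1 *: ((f \o shift (t *: v + x)) (h *: v) - f (t *: v + x))).
Proof.
by apply/funext => h; rewrite /= [h%:A]mulr1 scalerDl addrA.
Qed.

Lemma is_derive_line f x v (t : R) : derivable f (t *: v + x) v ->
  is_derive t 1 (fun s : R => f (s *: v + x)) ('D_v f (t *: v + x)).
Proof.
by move=> df; apply: DeriveDef; rewrite ?/derivable ?/derive line_growth_rate.
Qed.

(** Reduction to the chain rule on the line, because f is only assumed to be
    differentiable in the direction v. *)
Lemma is_derive_comp (g : R -> R) f x v :
  derivable f x v -> derivable g (f x) 1 ->
  is_derive x v (g \o f) ('D_1 g (f x) * 'D_v f x).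
Proof.
move=> df dg.
have x0 : x = 0 *: v + x by rewrite scale0r add0r.
rewrite x0 in df dg *.
have dl := is_derive_line _ _ _ _ df.
have dgl : derivable (g \o (fun s : R => f (s *: v + x))) 0 1.
  apply/derivable1_diffP/differentiable_comp; apply/derivable1_diffP.
    exact: (@ex_derive _ _ _ _ _ _ _ dl).
  exact: dg.
have dgf : derivable (g \o f) (0 *: v + x) v.
  by move: dgl; rewrite /derivable (line_growth_rate (g \o f)).
apply: DeriveDef => //.
have := @derive1_comp _ (fun s : R => f (s *: v + x)) g 0 _ dg.
rewrite !derive1E (@derive_val _ _ _ _ _ _ _ dl) => <-; last exact: ex_derive.
by rewrite (@derive_val _ _ _ _ _ _ _ (is_derive_line _ _ _ _ dgf)).
Qed.

Lemma MVT_line f x v (h : R) : 0 < h -> (forall y, derivable f y v) ->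
  exists2 c, 0 < c < h & f (h *: v + x) - f x = h * 'D_v f (c *: v + x).
Proof.
move=> h0 df.
have dl (t : R) : is_derive t 1 (fun s : R => f (s *: v + x)) ('D_v f (t *: v + x)).
  exact/is_derive_line/df.
have [|c c0h] := @MVT _ (fun s : R => f (s *: v + x)) _ 0 h h0 (fun t _ => dl t).
  by apply: derivable_within_continuous => t _; exact: ex_derive.
rewrite scale0r add0r subr0 mulrC => fE; by exists c.
Qed.

Lemma cvg_line x v : h *: v + x @[h --> (0:R)] --> x.
Proof.
rewrite -[X in _ --> X]add0r -[X in _ --> X + _](scale0r v).
by apply: cvgD; [apply: cvgZr_tmp|exact: cvg_cst].
Qed.

(** The difference quotient is nonpositive on one side and nonnegative on the
    other; differentiability is assumed at the point x only. *)
Lemma derive_local_min f x v : derivable f x v ->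
  (\forall y \near x, f x <= f y) -> 'D_v f x = 0.
Proof.
move=> df /(cvg_line x v) fmin.
set q := fun h : R => h^-1 *: ((f \o shift x) (h *: v) - f x).
have qD : q h @[h --> 0^'] --> 'D_v f x by exact: df.
have [r r0 rP] : exists2 r : R, 0 < r & forall h, `|h| < r -> f x <= f (h *: v + x).
  by move: fmin => /nbhs_normP[r /= r0 rP]; exists r => // h hr;
    apply: rP; rewrite /= sub0r normrN.
apply/eqP; case: ltgtP => // D0; exfalso.
- have /= [e /= e0 eP] := cvgr_lt _ qD _ D0.
  pose h := Num.min r e / 2.
  have h0 : 0 < h by rewrite divr_gt0// lt_min r0 e0.
  have [hr he] : h < r /\ h < e.
    by apply/andP; rewrite -lt_min /h; rewrite /h in h0; lra.
  have := eP h; rewrite /= sub0r normrN gtr0_norm// => /(_ he (lt0r_neq0 h0)).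
  rewrite /q /= ltNge => /negP; apply; rewrite /GRing.scale/= mulr_ge0//.
    by rewrite invr_ge0 ltW.
  by rewrite subr_ge0 rP// gtr0_norm.
- have /= [e /= e0 eP] := cvgr_gt _ qD _ D0.
  pose h := Num.min r e / 2.
  have h0 : 0 < h by rewrite divr_gt0// lt_min r0 e0.
  have [hr he] : h < r /\ h < e.
    by apply/andP; rewrite -lt_min /h; rewrite /h in h0; lra.
  have := eP (- h); rewrite /= sub0r opprK gtr0_norm// oppr_eq0.
  move=> /(_ he (lt0r_neq0 h0)).
  rewrite /q /= ltNge => /negP; apply; rewrite /GRing.scale/= mulr_le0_ge0//.
    by rewrite invr_le0 oppr_le0 ltW.
  by rewrite subr_ge0 rP// normrN gtr0_norm.
Qed.

End directional.

Section Ck_theory.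
Context {R : realType} {N : nat}.
Implicit Types (f g : 'rV[R]_N -> R) (U : set 'rV[R]_N).

Lemma Ck0P U f : Ck 0 U f <-> forall x, U x -> {for x, continuous f}.
Proof.
split=> [[cf _] x Ux|cf]; first exact: (cf [::]).
by split=> // -[].
Qed.

(** Peels off the innermost derivative rather than the outermost one. This is
    the form that allows induction on k for all functions simultaneously. *)
Lemma CkSP k U f : Ck k.+1 U f <->
  [/\ forall x, U x -> {for x, continuous f},
      forall i x, U x -> derivable f x (delta_mx 0 i) &
      forall i, Ck k U (partial i f)].
Proof.
have rc s i : partials (rcons s i) f = partials s (partial i f).
  by rewrite /partials foldr_rcons.
split=> [[cf df]|[cf df dfk]].
  split=> [x Ux|i x Ux|i]; [exact: (cf [::])|exact: (df [::])|split].
    by move=> s sk x Ux; rewrite -rc; apply: cf; rewrite ?size_rcons.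
  by move=> s j sk x Ux; rewrite -rc; apply: df; rewrite ?size_rcons.
split=> [s|s j].
  case/lastP: s => [|s i] //; rewrite size_rcons rc => sk x Ux.
  exact: (dfk i).1.
case/lastP: s => [|s i]; first by move=> _ x Ux; exact: df.
by rewrite size_rcons rc => sk x Ux; exact: (dfk i).2.
Qed.

Lemma Ck_le j k U f : (j <= k)%N -> Ck k U f -> Ck j U f.
Proof.
move=> jk [cf df]; split=> [s sj|s i sj]; [apply: cf|apply: df].
  exact: leq_trans jk.
exact: leq_trans jk.
Qed.

Lemma CkSW k U f : Ck k.+1 U f -> Ck k U f.
Proof. exact: Ck_le. Qed.

Lemma Ck_sub k U W f : W `<=` U -> Ck k U f -> Ck k W f.
Proof.
by move=> WU [cf df]; split=> [s sk x /WU|s i sk x /WU]; [exact: cf|exact: df].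
Qed.

Lemma continuous_eq_on U f g x : open U -> (forall y, U y -> f y = g y) -> U x ->
  {for x, continuous f} -> {for x, continuous g}.
Proof.
move=> oU fg Ux; rewrite /prop_for /continuous_at -(fg x Ux) => cfx.
have fgx : {near x, f =1 g}.
  by apply: filterS (open_nbhs_nbhs (conj oU Ux)) => y; exact: fg.
exact: cvg_trans (near_eq_cvg fgx) cfx.
Qed.

Lemma partial_eq_on U f g i : open U -> (forall x, U x -> f x = g x) ->
  forall x, U x -> partial i f x = partial i g x.
Proof.
move=> oU fg x Ux; apply: near_eq_derive; near=> y; apply: fg; near: y.
exact: open_nbhs_nbhs.
Unshelve. all: by end_near. Qed.

Lemma Ck_eq_on k U f g : open U -> (forall x, U x -> f x = g x) ->
  Ck k U f -> Ck k U g.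
Proof.
move=> oU; elim: k f g => [|k IH] f g fg.
  move=> /Ck0P cf; apply/Ck0P => x Ux.
  exact: continuous_eq_on U f g x oU fg Ux (cf x Ux).
move=> /CkSP[cf df dfk]; apply/CkSP; split=> [x Ux|i x Ux|i].
- exact: continuous_eq_on U f g x oU fg Ux (cf x Ux).
- apply: near_eq_derivable (df i x Ux); near=> y; apply: fg; near: y.
  exact: open_nbhs_nbhs.
- exact: IH (partial_eq_on U f g i oU fg) (dfk i).
Unshelve. all: by end_near. Qed.

Lemma Ck_local k U f :
  (forall x, U x -> exists W, [/\ open W, W x & Ck k W f]) -> Ck k U f.
Proof.
move=> fW; split=> [s sk x /fW|s i sk x /fW] [W [oW Wx [cf df]]].
  exact: cf.
exact: df.
Qed.

Lemma Ck_cst k U a : Ck k U (fun=> a).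
Proof.
elim: k a => [|k IH] a; first by apply/Ck0P => x _; exact: cst_continuous.
apply/CkSP; split=> [x _|i x _|i]; [exact: cst_continuous|exact: (derivable_cst a)|].
rewrite (_ : partial i _ = fun=> 0); first exact: IH.
by apply/funext => x; exact: (derive_cst a).
Qed.

Lemma partialD f g i x : derivable f x (delta_mx 0 i) ->
  derivable g x (delta_mx 0 i) ->
  partial i (fun y => f y + g y) x = partial i f x + partial i g x.
Proof. exact: deriveD. Qed.

Lemma partialM f g i x : derivable f x (delta_mx 0 i) ->
  derivable g x (delta_mx 0 i) ->
  partial i (fun y => f y * g y) x = f x * partial i g x + g x * partial i f x.
Proof. exact: deriveM. Qed.

Lemma CkD k U f g : open U -> Ck k U f -> Ck k U g ->
  Ck k U (fun x => f x + g x).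
Proof.
move=> oU; elim: k f g => [|k IH] f g.
  move=> /Ck0P cf /Ck0P cg; apply/Ck0P => x Ux.
  exact: (continuousD (cf x Ux) (cg x Ux)).
move=> /CkSP[cf df dfk] /CkSP[cg dg dgk]; apply/CkSP; split=> [x Ux|i x Ux|i].
- exact: (continuousD (cf x Ux) (cg x Ux)).
- by apply: derivableD; [exact: df|exact: dg].
- apply: (Ck_eq_on _ _ _ _ oU _) (IH _ _ (dfk i) (dgk i)) => x Ux.
  by rewrite partialD//; [exact: df|exact: dg].
Qed.

Lemma CkM k U f g : open U -> Ck k U f -> Ck k U g ->
  Ck k U (fun x => f x * g x).
Proof.
move=> oU; elim: k f g => [|k IH] f g.
  move=> /Ck0P cf /Ck0P cg; apply/Ck0P => x Ux.
  exact: (continuousM (cf x Ux) (cg x Ux)).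
move=> fS gS; move: (fS) (gS) => /CkSP[cf df dfk] /CkSP[cg dg dgk].
apply/CkSP; split=> [x Ux|i x Ux|i].
- exact: (continuousM (cf x Ux) (cg x Ux)).
- by apply: derivableM; [exact: df|exact: dg].
- apply: (Ck_eq_on _ _ _ _ oU _) (CkD k U _ _ oU (IH _ _ (CkSW _ _ _ fS) (dgk i))
    (IH _ _ (CkSW _ _ _ gS) (dfk i))) => x Ux.
  by rewrite partialM//; [exact: df|exact: dg].
Qed.

Lemma Ck_sum k U (I : Type) (r : seq I) (F : I -> 'rV[R]_N -> R) : open U ->
  (forall i, Ck k U (F i)) -> Ck k U (fun x => \sum_(i <- r) F i x).
Proof.
move=> oU cF; elim: r => [|i r IH].
  by under eq_fun do rewrite big_nil; exact: Ck_cst.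
by under eq_fun do rewrite big_cons; exact: CkD.
Qed.

Lemma Ck_prod k U (I : Type) (r : seq I) (F : I -> 'rV[R]_N -> R) : open U ->
  (forall i, Ck k U (F i)) -> Ck k U (fun x => \prod_(i <- r) F i x).
Proof.
move=> oU cF; elim: r => [|i r IH].
  by under eq_fun do rewrite big_nil; exact: Ck_cst.
by under eq_fun do rewrite big_cons; exact: CkM.
Qed.

Lemma CkV k U f : open U -> (forall x, U x -> f x != 0) -> Ck k U f ->
  Ck k U (fun x => (f x)^-1).
Proof.
move=> oU f0; elim: k => [|k IH].
  by move=> /Ck0P cf; apply/Ck0P => x Ux; exact: (continuousV (f0 x Ux) (cf x Ux)).
move=> fS; move: (fS) => /CkSP[cf df dfk].
have fV := IH (CkSW _ _ _ fS).
apply/CkSP; split=> [x Ux|i x Ux|i].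
- exact: (continuousV (f0 x Ux) (cf x Ux)).
- exact: (derivableV (f0 x Ux) (df i x Ux)).
- have fV2 := CkM k U _ _ oU (Ck_cst k U (-1)) (CkM k U _ _ oU fV fV).
  apply: (Ck_eq_on _ _ _ _ oU _) (CkM k U _ _ oU fV2 (dfk i)) => x Ux.
  rewrite /partial (deriveV (f0 x Ux))//; last exact: df.
  by rewrite /GRing.scale/= mulN1r -invfM -expr2.
Qed.

(** All iterated derivatives exist, hence are continuous. *)
Definition smooth_line (g : R -> R) : Prop :=
  forall n t, derivable (iter n (fun h : R -> R => fun t => 'D_1 h t) g) t 1.

Lemma smooth_lineP (g : R -> R) : smooth_line g <->
  (forall t, derivable g t 1) /\ smooth_line (fun t => 'D_1 g t).
Proof.
split=> [gs|[dg gs] [|n] t]; [split=> [t|n t]|exact: dg|].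
- exact: (gs 0).
- by have := gs n.+1 t; rewrite iterSr.
- by rewrite iterSr; exact: gs.
Qed.

Lemma Ck_comp k U (g : R -> R) f : open U -> smooth_line g -> Ck k U f ->
  Ck k U (fun x => g (f x)).
Proof.
move=> oU; elim: k g => [|k IH] g /smooth_lineP[dg gs].
  move=> /Ck0P cf; apply/Ck0P => x Ux; apply: continuous_comp; first exact: (cf x Ux).
  exact/differentiable_continuous/derivable1_diffP/dg.
move=> fS; move: (fS) => /CkSP[cf df dfk]; apply/CkSP; split=> [x Ux|i x Ux|i].
- apply: continuous_comp; first exact: (cf x Ux).
  exact/differentiable_continuous/derivable1_diffP/dg.
- exact: (@ex_derive _ _ _ _ _ _ _ (is_derive_comp _ _ _ _ (df i x Ux) (dg _))).
- have g'f := IH _ gs (CkSW _ _ _ fS).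
  apply: (Ck_eq_on _ _ _ _ oU _) (CkM k U _ _ oU g'f (dfk i)) => x Ux.
  have dgf := is_derive_comp _ _ _ _ (df i x Ux) (dg (f x)).
  by rewrite /partial (@derive_val _ _ _ _ _ _ _ dgf).
Qed.

Lemma Ck_coord k U (j : 'I_N) : open U -> Ck k U (fun x => x 0 j).
Proof.
move=> oU.
have dj (x v : 'rV[R]_N) : derivable (fun y : 'rV[R]_N => y 0 j) x v.
  exact/diff_derivable/differentiable_coord.
have ej (x v : 'rV[R]_N) : 'D_v (fun y : 'rV[R]_N => y 0 j) x = v 0 j.
  have idE : 'D_v (@id 'rV[R]_N) x =
      \matrix_(i, j) 'D_v (fun y : 'rV[R]_N => y i j) x.
    by apply: derive_mx; exact: derivable_id.
  by move: idE; rewrite derive_id => {2}->; rewrite mxE.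
case: k => [|k].
  by apply/Ck0P => x _; exact: coord_continuous.
apply/CkSP; split=> [x _|i x _|i]; [exact: coord_continuous|exact: dj|].
have cij := Ck_cst k U ((delta_mx 0 i : 'rV[R]_N) 0 j).
by apply: (Ck_eq_on _ _ _ _ oU _) cij => x _; rewrite /partial ej.
Qed.

Lemma partial_sum (J : Type) (r : seq J) (F : J -> 'rV[R]_N -> R) i x :
  (forall j, derivable (F j) x (delta_mx 0 i)) ->
  is_derive x (delta_mx 0 i) (fun y => \sum_(j <- r) F j y)
    (\sum_(j <- r) partial i (F j) x).
Proof.
move=> dF; elim: r => [|j r IH].
  by rewrite big_nil; under eq_fun do rewrite big_nil; exact: is_derive_cst.
rewrite big_cons; under eq_fun do rewrite big_cons.
exact: (is_deriveD (derivableP (dF j)) IH).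
Qed.

End Ck_theory.

(** * Integrals of partial derivatives; flat functions *)

Section integration_by_parts.
Context {R : realType} {N : nat}.
Implicit Types f : 'rV[R]_N -> R.
Notation I f := (integral_rV f).

Lemma norm_delta_le (i : 'I_N) : `|delta_mx 0 i : 'rV[R]_N| <= 1.
Proof.
by apply: rV_norm_le => // j; rewrite mxE eqxx/=; case: eqP; rewrite ?normr1 ?normr0.
Qed.

Lemma partial_eq0_out f L i : (forall x, L < `|x| -> f x = 0) ->
  forall x, L < `|x| -> partial i f x = 0.
Proof.
move=> fL x Lx; have oL : open [set y : 'rV[R]_N | L < `|y|].
  rewrite (_ : [set _ | _] = (fun y : 'rV[R]_N => `|y|) @^-1` [set r | L < r])//.
  by apply: open_comp; [move=> y _; exact: norm_continuous|exact: open_gt].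
rewrite (partial_eq_on _ f (fun=> 0) i oL _ x Lx) /partial; last exact: fL.
exact: (derive_cst 0).
Qed.

Lemma cc_partial f i : cc f -> continuous (partial i f) -> cc (partial i f).
Proof. by move=> [_ [L fL]] cpf; split=> //; exists L; exact: partial_eq0_out. Qed.

(** The difference quotients (f(x + h e_i) - f(x)) / h have integral zero by
    translation invariance, and converge to the partial derivative uniformly, with
    supports in a fixed ball. *)
Lemma integral_rV_partial f i : cc f ->
  (forall x, derivable f x (delta_mx 0 i)) -> continuous (partial i f) ->
  I (partial i f) = 0.
Proof.
move=> ccf df cpf; have ccp := cc_partial f i ccf cpf.
have [_ [L fL]] := ccf.
set e1 := delta_mx 0 i : 'rV[R]_N.
have e1_le (h : R) : `|h *: e1| <= `|h|.
  by rewrite normrZ ler_piMr ?norm_delta_le.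
(* Increments of norm less than 1 keep the supports in the ball of radius M. *)
pose M := `|L| + 1; have M0 : 0 <= M by rewrite addr_ge0.
have LM : L < M by rewrite (le_lt_trans (ler_norm L))// ltrDl.
suff small e : 0 < e -> `|I (partial i f)| <= e * (2 * M) ^+ N.
  apply/eqP; rewrite -normr_le0; apply/ler_addgt0Pl => e e0; rewrite addr0.
  have C0 : 0 < (2 * M) ^+ N + 1 by rewrite ltr_wpDl// exprn_ge0// mulr_ge0.
  apply: le_trans (small _ (divr_gt0 e0 C0)) _.
  by rewrite mulrAC ler_pdivrMr// ler_pM2l// lerDl.
move=> e0; have [d d0 pd] := cc_unif_continuous _ ccp e e0.
pose h := Num.min d 1 / 2.
have m0 : 0 < Num.min d 1 by rewrite lt_min d0 ltr01.
have h0 : 0 < h by rewrite divr_gt0.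
have [hd h1] : h < d /\ h < 1 by apply/andP; rewrite -lt_min /h; lra.
pose q x := h^-1 * (f (x + h *: e1) - f x).
have ccq : cc q by apply/ccZ/ccB => //; exact: cc_shift.
have Iq : I q = 0.
  rewrite integral_rVZ; last by apply: ccB => //; exact: cc_shift.
  by rewrite integral_rVB ?integral_rV_shift ?subrr ?mulr0//; exact: cc_shift.
rewrite -[X in `|X|]subr0 -Iq -integral_rVB//.
apply: norm_integral_rV_le => //; first exact: ccB.
- move=> x Mx; rewrite (partial_eq0_out f L i fL)//; last exact: lt_trans Mx.
  rewrite /q !fL ?subrr ?mulr0 ?subrr//; first exact: lt_trans Mx.
  have := lerB_dist x (- (h *: e1)); rewrite normrN opprK.
  have := e1_le h; rewrite (gtr0_norm h0) => ? ?.
  have := ler_norm L; rewrite /M in Mx; lra.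
- move=> x; have [c /andP[c0 ch] fc] := MVT_line f x e1 h h0 df.
  rewrite /q [x + _]addrC fc mulKf ?gt_eqF//; apply/ltW/pd.
  rewrite opprD addrCA subrr addr0 normrN (le_lt_trans (e1_le c))//.
  by rewrite gtr0_norm// (lt_trans ch).
Qed.

Lemma integral_rV_Ck1_partial f i : cc f -> Ck 1 setT f -> I (partial i f) = 0.
Proof.
move=> ccf /CkSP[_ df /(_ i) /Ck0P cpf]; apply: integral_rV_partial => // x.
  exact: df.
exact: cpf.
Qed.

End integration_by_parts.

Section flat_function.
Context {R : realType}.
Implicit Types (p q : {poly R}).

(** The functions p(1/t) exp(-1/t) for t > 0, extended by zero. The polynomial is
    there because this class, unlike exp(-1/t) alone, is stable under
    differentiation. *)
Definition flat p (t : R) : R := if t <= 0 then 0 else p.[t^-1] * expR (- t^-1).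

Lemma norm_horner_le p : exists2 C, 0 <= C &
  forall y, 1 <= y -> `|p.[y]| <= C * y ^+ size p.
Proof.
exists (\sum_(i < size p) `|p`_i|); first by rewrite sumr_ge0.
move=> y y1; rewrite horner_coef (le_trans (ler_norm_sum _ _ _))// mulr_suml.
apply: ler_sum => i _; rewrite normrM normrX (ger0_norm (le_trans ler01 y1)).
by rewrite ler_wpM2l// ler_weXn2l// ltnW.
Qed.

Lemma expr_le_expR (n : nat) (y : R) : 0 <= y -> y ^+ n <= n`!%:R * expR y.
Proof.
case: n => [|n] y0; first by rewrite expr0 mul1r -expR0 ler_expR.
rewrite mulrC -ler_pdivrMr ?ltr0n ?fact_gt0//.
by apply: le_trans (expR_ge1Dxn n y0); rewrite lerDr.
Qed.

(** The bound exp y >= y^n / n! at y = 1/t. It gives the derivative of flat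
    functions at 0. *)
Lemma flat_le p : exists2 C, 0 <= C & forall t, `|t| <= 1 -> `|flat p t| <= C * `|t|.
Proof.
have [C C0 pC] := norm_horner_le p.
exists (C * (size p).+1`!%:R); first by rewrite mulr_ge0.
move=> t t1; rewrite /flat; case: ifPn => [_|].
  by rewrite normr0 !mulr_ge0.
rewrite -ltNge => t0; rewrite gtr0_norm// in t1 *.
have y1 : 1 <= t^-1 by rewrite -invr1 lef_pV2// posrE.
rewrite normrM (gtr0_norm (expR_gt0 _)) expRN ler_pdivrMr ?expR_gt0//.
apply: (le_trans (pC _ y1)); rewrite -!mulrA ler_wpM2l//.
have := expr_le_expR (size p).+1 t^-1; rewrite invr_ge0 (ltW t0) => /(_ isT).
by rewrite exprS ler_pdivrMl// mulrCA.
Qed.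

(** At 0 the difference quotient of the flat function of p is the flat function
    of 'X * p, which tends to 0 by flat_le. *)
Lemma flat_is_derive p (t : R) :
  is_derive t 1 (flat p) (flat ('X^2 * (p - p^`())) t).
Proof.
have [t0|t0|->] := ltgtP t 0.
- have -> : flat ('X^2 * (p - p^`())) t = 0 by rewrite /flat ltW.
  apply: (@near_eq_is_derive _ _ _ (cst 0 : R -> R)).
  by near=> s; rewrite /flat ifT//; apply: ltW; near: s; exact: lt_nbhsl.
- apply: (@near_eq_is_derive _ _ _ (fun s : R => p.[s^-1] * expR (- s^-1))).
    near=> s; rewrite /flat ifF//; apply/negbTE; rewrite -ltNge.
    by near: s; exact: lt_nbhsr.
  have dV : is_derive t (1:R) (fun s : R => s^-1) (- t ^- 2).
    have t0' : id t != 0 by rewrite gt_eqF.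
    apply: is_derive_eq (is_deriveV t0' (is_derive_id t 1)) _.
    by rewrite /GRing.scale/= mulr1.
  have dp : is_derive t (1:R) (fun s : R => p.[s^-1]) (p^`().[t^-1] * - t ^- 2).
    have dh := @derivable_horner R p t^-1.
    have := is_derive_comp (horner p) (fun s : R => s^-1) t 1
      (@ex_derive _ _ _ _ _ _ _ dV) dh.
    rewrite (@derive_val _ _ _ _ _ _ _ dV) -derive1E -derivE; exact.
  have dN : is_derive t (1:R) (fun s : R => - s^-1) (t ^- 2).
    by apply: is_derive_eq (is_deriveN dV) _; rewrite opprK.
  have de : is_derive t (1:R) (fun s : R => expR (- s^-1)) (expR (- t^-1) * t ^- 2).
    have := is_derive_comp expR (fun s : R => - s^-1) t 1
      (@ex_derive _ _ _ _ _ _ _ dN) (@derivable_expR R (- t^-1)).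
    rewrite (@derive_val _ _ _ _ _ _ _ dN).
    by rewrite (congr1 (fun g => g (- t^-1)) (@derive_expR R)).
  apply: is_derive_eq (is_deriveM dp de) _.
  rewrite /flat ifF; last by apply/negbTE; rewrite -ltNge.
  rewrite hornerM hornerD hornerN hornerXn exprVn /GRing.scale/=; ring.
- have -> : flat ('X^2 * (p - p^`())) 0 = 0 by rewrite /flat lexx.
  have [C C0 pC] := flat_le ('X * p).
  have fX h : h^-1 * flat p h = flat ('X * p) h.
    by rewrite /flat; case: ifPn; rewrite ?mulr0// hornerM hornerX mulrA.
  suff qcvg : h^-1 *: ((flat p \o shift 0) (h *: (1 : R)) - flat p 0)
      @[h --> 0^'] --> (0 : R).
    by apply: DeriveDef; [apply/cvg_ex; exists 0|exact: cvg_lim].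
  have C1 : 0 < C + 1 by lra.
  apply/cvgrPdist_le => e e0; have eC : 0 < e / (C + 1) by rewrite divr_gt0.
  near=> h.
  rewrite /= addr0 [h%:A]mulr1 {2}/flat lexx subr0 sub0r normrN /GRing.scale/= fX.
  have h1 : `|h| <= 1 by near: h; exact: dnbhs0_le.
  apply: (le_trans (pC _ h1)).
  have : `|h| <= e / (C + 1).
    by near: h; exact: dnbhs0_le.
  rewrite ler_pdivlMr// mulrDr mulr1 mulrC; have := normr_ge0 h; lra.
Unshelve. all: by end_near. Qed.

Lemma smooth_line_flat p : smooth_line (flat p).
Proof.
move=> n t; elim: n p => [|n IH] p.
  exact: (@ex_derive _ _ _ _ _ _ _ (flat_is_derive p t)).
rewrite iterSr (_ : (fun t => _) = flat ('X^2 * (p - p^`()))); first exact: IH.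
by apply/funext => s; exact: (@derive_val _ _ _ _ _ _ _ (flat_is_derive p s)).
Qed.

End flat_function.

(** * Test functions and the fundamental lemma *)

Section test_functions.
Context {R : realType} {N : nat}.
Implicit Types f phi : 'rV[R]_N -> R.
Notation I f := (integral_rV f).

Lemma smooth_continuous f : smooth setT f -> continuous f.
Proof. by move=> /(_ 0) /Ck0P cf x; exact: cf. Qed.

Lemma test_function_cc U phi : test_function U phi -> cc phi.
Proof.
move=> [sp /compact_bounded[M [_ pM]] _]; split; first exact: smooth_continuous.
exists (`|M| + 1) => x Mx; apply/eqP/negPn/negP => px0.
have : `|x| <= `|M| + 1.
  apply: pM; last exact: subset_closure.
  by rewrite (le_lt_trans (ler_norm M))// ltrDl.
by rewrite leNgt Mx.
Qed.

(** Positive exactly on the open cube of centre a and half side r. *)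
Definition bump (a : 'rV[R]_N) (r : R) (x : 'rV[R]_N) : R :=
  \prod_(j < N) (flat 1 (r + (x 0 j - a 0 j)) * flat 1 (r - (x 0 j - a 0 j))).

Lemma flat1_ge0 (t : R) : 0 <= flat 1 t.
Proof. by rewrite /flat hornerC; case: ifP => // _; rewrite mul1r expR_ge0. Qed.

Lemma flat1_gt0 (t : R) : 0 < t -> 0 < flat 1 t.
Proof. by move=> t0; rewrite /flat hornerC leNgt t0/= mul1r expR_gt0. Qed.

Lemma flat_le0 p (t : R) : t <= 0 -> flat p t = 0.
Proof. by move=> t0; rewrite /flat t0. Qed.

Lemma bump_ge0 a r x : 0 <= bump a r x.
Proof. by apply: prodr_ge0 => j _; rewrite mulr_ge0// flat1_ge0. Qed.

Lemma bump_center_gt0 a r : 0 < r -> 0 < bump a r a.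
Proof.
move=> r0; apply: prodr_gt0 => j _.
by rewrite subrr addr0 subr0 mulr_gt0// flat1_gt0.
Qed.

Lemma bump_out a r x : 0 <= r -> r < `|x - a| -> bump a r x = 0.
Proof.
move=> r0 rx; apply/eqP; apply: contraTT rx => xN0; rewrite -leNgt.
apply: rV_norm_le => // j; rewrite leNgt; apply/negP => xj; case/negP: xN0.
rewrite /bump (bigD1 j)//=; move: xj; rewrite mxE [X in _ + X]mxE.
rewrite lter_normr => /orP[xj|xj]; apply/eqP.
  by rewrite (flat_le0 _ (r - _)) ?mulr0 ?mul0r//; lra.
by rewrite (flat_le0 _ (r + _)) ?mul0r//; lra.
Qed.

Lemma smooth_bump a r : smooth setT (bump a r).
Proof.
move=> k; apply: Ck_prod => [|j]; first exact: openT.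
have cj : Ck k setT (fun x : 'rV[R]_N => x 0 j - a 0 j).
  apply: CkD; [exact: openT|apply: Ck_coord; exact: openT|exact: Ck_cst].
apply: CkM; [exact: openT| |].
- apply: (Ck_comp k setT (flat 1) (fun x => r + (x 0 j - a 0 j)) openT).
    exact: smooth_line_flat.
  by apply: CkD; [exact: openT|exact: Ck_cst|].
- apply: (Ck_comp k setT (flat 1) (fun x => r - (x 0 j - a 0 j)) openT).
    exact: smooth_line_flat.
  apply: CkD; [exact: openT|exact: Ck_cst|].
  have := CkM k setT _ _ openT (Ck_cst k setT (-1)) cj.
  by congr (Ck _ _ _); apply/funext => x; rewrite mulN1r.
Qed.

Lemma test_function_bump a r : 0 <= r -> test_function setT (bump a r).
Proof.
move=> r0; split=> //; first exact: smooth_bump.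
apply: (subclosed_compact _ (rV_ball_compact (`|a| + r))); first exact: closed_closure.
have cl : closed [set x : 'rV[R]_N | `|x| <= `|a| + r].
  by apply: compact_closed; [exact: norm_hausdorff|exact: rV_ball_compact].
rewrite [X in _ `<=` X](closure_id _).1//; apply: closure_subset => x /=.
apply: contraNT; rewrite -ltNge => rx; apply/eqP/bump_out => //.
have := lerB_dist x a; lra.
Qed.

(** If f were positive at a point, a bump function supported where f > 0 would
    give a positive integral; the case of a negative value is symmetric. *)
Lemma fundamental_lemma f : continuous f ->
  (forall phi, test_function setT phi -> I (fun x => f x * phi x) = 0) ->
  forall x, f x = 0.
Proof.
move=> cf If; suff neg (g : 'rV[R]_N -> R) : continuous g ->
    (forall phi, test_function setT phi -> I (fun x => g x * phi x) = 0) ->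
    forall x, g x <= 0.
  move=> x; apply/eqP; rewrite eq_le (neg f)//= -oppr_le0.
  apply: (neg (fun x => - f x)) => [y|phi tp]; first exact/continuousN/cf.
  rewrite -[RHS]oppr0 -(If phi tp) -integral_rVN; last first.
    by apply: ccMl => //; exact: test_function_cc tp.
  by congr integral_rV; apply/funext => y; rewrite mulNr.
move=> {cf If} cg Ig x; rewrite leNgt; apply/negP => gx.
have [r r0 gr] := (continuous_epsP g x).1 (cg x) _ gx.
have r20 : 0 < r / 2 by rewrite divr_gt0.
have tb := test_function_bump x _ (ltW r20).
have ccgb : cc (fun y => g y * bump x (r / 2) y).
  by apply: ccMl => //; exact: test_function_cc tb.
have gb0 y : 0 <= g y * bump x (r / 2) y.
  have [yx|yx] := lerP `|y - x| (r / 2); last by rewrite bump_out ?mulr0// ltW.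
  rewrite mulr_ge0 ?bump_ge0//.
  have : `|g x - g y| < g x by apply: gr; rewrite distrC; lra.
  by rewrite ltr_norml => /andP[_]; lra.
have := integral_rV_eq0 _ _ ccgb gb0 (Ig _ tb) x => /eqP.
by rewrite mulf_eq0 !gt_eqF//; exact: bump_center_gt0.
Qed.

End test_functions.

(** * Positive semi-definite forms, positive parts, extension by zero *)

Section psd.
Context {F : realFieldType} {N : nat}.

(** If v A v^T = 0 then v A w^T = 0 for all w: otherwise the quadratic polynomial
    t |-> (v + t w) A (v + t w)^T, which has no constant term, would take negative
    values. *)
Lemma psd_isotropic (A : 'M[F]_N) (v : 'rV[F]_N) : A^T = A ->
  (forall w : 'rV[F]_N, 0 <= (w *m A *m w^T) 0 0) ->
  (v *m A *m v^T) 0 0 = 0 -> v *m A = 0.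
Proof.
move=> As Ap vv0; apply/rowP => j; rewrite [RHS]mxE.
set b := (v *m A) 0 j; pose w := delta_mx 0 j : 'rV[F]_N.
have vw : (v *m A *m w^T) 0 0 = b by rewrite trmx_delta -colE mxE.
have wv : (w *m A *m v^T) 0 0 = b.
  have -> : w *m A *m v^T = (v *m A *m w^T)^T.
    by rewrite !trmx_mul trmxK As mulmxA.
  by rewrite mxE.
set a := (w *m A *m w^T) 0 0.
have a0 : 0 <= a by exact: Ap.
have a1 : 0 < a + 1 by lra.
(* The minimizer is - b / a; the shift avoids a case distinction on a = 0. *)
pose t := - b / (a + 1).
have := Ap (v + t *: w).
have -> : ((v + t *: w) *m A *m (v + t *: w)^T) 0 0 =
    t * b + (t * b + t * (t * a)).
  rewrite raddfD/= linearZ/= !mulmxDl !mulmxDr -!scalemxAl -!scalemxAr.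
  move: vv0 vw wv; rewrite /a; move: (v *m A *m v^T) (v *m A *m w^T).
  move: (w *m A *m v^T) (w *m A *m w^T) => P1 P2 P3 P4 P30 P4b P1b.
  by rewrite !mxE P30 P4b P1b; ring.
have -> : t * b + (t * b + t * (t * a)) = - (b ^+ 2 * ((a + 2) / (a + 1) ^+ 2)).
  by rewrite /t; field; rewrite gt_eqF.
rewrite oppr_ge0 pmulr_lle0; last by rewrite divr_gt0 ?exprn_gt0//; lra.
by move=> b2; apply/eqP; rewrite -sqrf_eq0 eq_le b2 sqr_ge0.
Qed.

End psd.

Section truncation.
Context {R : realType}.

Definition pos (t : R) : R := Num.max 0 t.

Lemma pos_ge0 t : 0 <= pos t. Proof. by rewrite le_max lexx. Qed.

Lemma ge_pos t : t <= pos t. Proof. by rewrite le_max lexx orbT. Qed.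

Lemma pos_eq0 t : t <= 0 -> pos t = 0.
Proof. by move=> t0; rewrite /pos; case: ltgtP t0 => //. Qed.

Lemma pos_id t : 0 <= t -> pos t = t.
Proof. by move=> t0; rewrite /pos; case: ltgtP t0 => //. Qed.

Lemma continuous_pos : continuous pos.
Proof.
apply: lipschitz1_continuous => x y; rewrite /pos ler_norml.
have := ler_norm (x - y); have := ler_norm (y - x); rewrite (distrC y x).
by case: (ltP 0 x) => x0; case: (ltP 0 y) => y0 ? ?; apply/andP; split; lra.
Qed.

(** The square is what makes the truncation C^1: the derivative exists at 0
    because the difference quotient there is at most |h|. *)
Lemma is_derive_sqr_pos (t : R) : is_derive t 1 (fun s : R => pos s ^+ 2) (2 * pos t).
Proof.
have [t0|t0|->] := ltgtP t 0.
- rewrite pos_eq0 ?ltW// mulr0.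
  apply: (@near_eq_is_derive _ _ _ (cst 0 : R -> R)).
  near=> s; rewrite pos_eq0 ?expr0n//; apply: ltW; near: s; exact: lt_nbhsl.
- rewrite pos_id ?ltW//.
  apply: (@near_eq_is_derive _ _ _ (fun s : R => s ^+ 2)).
    near=> s; rewrite pos_id//; apply: ltW; near: s; exact: lt_nbhsr.
  apply: DeriveDef; first exact: exprn_derivable.
  by rewrite exp_derive /GRing.scale/= mulr1 expr1 mulr_natl.
- rewrite pos_eq0// mulr0.
  suff qcvg : h^-1 *: (((fun s : R => pos s ^+ 2) \o shift 0) (h *: (1 : R)) -
      pos 0 ^+ 2) @[h --> 0^'] --> (0 : R).
    by apply: DeriveDef; [apply/cvg_ex; exists 0|exact: cvg_lim].
  apply/cvgrPdist_le => e e0; near=> h.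
  rewrite /= addr0 [h%:A]mulr1 (pos_eq0 0)// expr0n subr0 sub0r normrN.
  have he : `|h| <= e by near: h; exact: dnbhs0_le.
  apply: le_trans he; have [h0|h0] := leP h 0.
    by rewrite pos_eq0// expr0n/= scaler0 normr0.
  by rewrite (pos_id h (ltW h0)) /GRing.scale/= expr2 mulrA mulVf ?gt_eqF// mul1r.
Unshelve. all: by end_near. Qed.

End truncation.

Section zero_extension.
Context {R : realType} {N : nat}.
Implicit Types (f : 'rV[R]_N -> R) (Omega K : set 'rV[R]_N).

(** The whole space is covered by Omega and the complement of K, both open. *)
Lemma Ck_zero_extension k Omega K f : open Omega -> closed K ->
  K `<=` Omega -> Ck k Omega f -> (forall x, ~ K x -> f x = 0) ->
  Ck k setT f.
Proof.
move=> oO cK KO fO f0; apply: Ck_local => x _.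
have [Ox|nOx] := pselect (Omega x); first by exists Omega.
exists (~` K); split; first exact: closed_openC.
  by move=> /KO.
apply: Ck_eq_on (Ck_cst k (~` K) 0); first exact: closed_openC.
by move=> y /f0 ->.
Qed.

Lemma cc_zero_extension Omega K f : open Omega -> bounded_set K ->
  closed K -> K `<=` Omega -> Ck 0 Omega f -> (forall x, ~ K x -> f x = 0) ->
  cc f.
Proof.
move=> oO [M [_ KM]] cK KO fO f0; split.
  by move=> x; exact: ((Ck0P setT f).1 (Ck_zero_extension 0 Omega K f oO cK KO fO f0)).
exists (`|M| + 1) => x Mx; apply: f0 => Kx; move: Mx; apply/negP; rewrite -leNgt.
by apply: KM => //; rewrite (le_lt_trans (ler_norm M))// ltrDl.
Qed.

End zero_extension.

(** * Truncations of a subsolution *)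

Section truncated_subsolution.
Context {R : realType} {N : nat}.
Variables (V : 'rV[R]_N -> R) (A : 'rV[R]_N -> 'M[R]_N) (c : 'rV[R]_N -> R).
Hypotheses (V_smooth : smooth setT V) (V_gt0 : forall x, 0 < V x).
Hypothesis A_smooth : forall i j : 'I_N, smooth setT (fun x => A x i j).
Hypothesis A_sym : forall x, (A x)^T = A x.
Hypothesis A_psd : forall x (v : 'rV[R]_N), 0 <= (v *m A x *m v^T) 0 0.
Hypothesis c_ge0 : forall x, 0 <= c x.
Variables (Omega : set 'rV[R]_N) (u : 'rV[R]_N -> R).
Hypotheses (oO : open Omega) (bO : bounded_set Omega) (u2 : Ck 2 Omega u).
Hypothesis Lu_ge0 : forall x, Omega x -> 0 <= Lc V A c u x.

Definition superlevel (s : R) : set 'rV[R]_N := [set x | Omega x /\ s <= u x].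

Hypothesis superlevel_closed : forall s, 0 < s -> closed (superlevel s).

Notation I f := (integral_rV f).

Lemma superlevel_sub s : superlevel s `<=` Omega.
Proof. by move=> x []. Qed.

Lemma superlevel_bounded s : bounded_set (superlevel s).
Proof.
have [M [Mr OM]] := bO; exists M; split=> // L ML x [Ox _]; exact: OM L ML x Ox.
Qed.

Definition trunc (s : R) (x : 'rV[R]_N) : R :=
  if `[< Omega x >] then pos (u x - s) else 0.

(** The truncation (u - s)_+^2. The square makes it C^1, which suffices for the
    integrations by parts, but no more regular than that across noncritical points
    of {u = s}. *)
Definition sqtrunc (s : R) (x : 'rV[R]_N) : R := trunc s x ^+ 2.

Lemma truncE s x : Omega x -> trunc s x = pos (u x - s).
Proof. by move=> Ox; rewrite /trunc asboolT. Qed.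

Lemma trunc_ge0 s x : 0 <= trunc s x.
Proof. by rewrite /trunc; case: ifP => // _; exact: pos_ge0. Qed.

Lemma trunc_out s x : ~ superlevel s x -> trunc s x = 0.
Proof.
move=> sx; rewrite /trunc; case: asboolP => // Ox; apply: pos_eq0.
by rewrite leNgt; apply/negP => us; apply: sx; split=> //; lra.
Qed.

Lemma sqtrunc_out s x : ~ superlevel s x -> sqtrunc s x = 0.
Proof. by move=> /trunc_out; rewrite /sqtrunc => ->; rewrite expr0n. Qed.

Lemma u_continuous x : Omega x -> {for x, continuous u}.
Proof. by move=> Ox; move: u2 => /CkSP[cu _ _]; exact: cu. Qed.

Lemma u_derivable i x : Omega x -> derivable u x (delta_mx 0 i).
Proof. by move=> Ox; move: u2 => /CkSP[_ du _]; exact: du. Qed.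

Lemma partial_u_Ck1 i : Ck 1 Omega (partial i u).
Proof. by move: u2 => /CkSP[_ _]. Qed.

Lemma trunc_Ck0 s : Ck 0 Omega (trunc s).
Proof.
apply: (Ck_eq_on _ _ (fun x => pos (u x - s)) _ oO).
  by move=> x Ox; rewrite truncE.
apply/Ck0P => x Ox.
apply: (@continuous_comp _ _ _ (fun y => u y - s) pos); last exact: continuous_pos.
exact: (continuousB (u_continuous x Ox) (@cst_continuous _ _ s x)).
Qed.

Lemma sqtrunc_is_derive s i x : Omega x ->
  is_derive x (delta_mx 0 i) (sqtrunc s) (2 * trunc s x * partial i u x).
Proof.
move=> Ox; apply: (@near_eq_is_derive _ _ _ (fun y => pos (u y - s) ^+ 2)).
  apply: filterS (open_nbhs_nbhs (conj oO Ox)) => y Oy.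
  by rewrite /sqtrunc truncE.
have dus : is_derive x (delta_mx 0 i) (fun y => u y - s) (partial i u x).
  have du := derivableP (u_derivable i x Ox).
  by apply: is_derive_eq (is_deriveB du (is_derive_cst s x _)) _; rewrite subr0.
have dp := is_derive_sqr_pos (u x - s).
have := is_derive_comp (fun t : R => pos t ^+ 2) (fun y => u y - s) x (delta_mx 0 i)
  (@ex_derive _ _ _ _ _ _ _ dus) (@ex_derive _ _ _ _ _ _ _ dp).
by rewrite (@derive_val _ _ _ _ _ _ _ dus) (@derive_val _ _ _ _ _ _ _ dp) truncE.
Qed.

Lemma partial_sqtrunc s i x : Omega x ->
  partial i (sqtrunc s) x = 2 * trunc s x * partial i u x.
Proof. by move=> Ox; exact: (@derive_val _ _ _ _ _ _ _ (sqtrunc_is_derive s i x Ox)). Qed.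

Lemma sqtrunc_Ck1_in s : Ck 1 Omega (sqtrunc s).
Proof.
have tC := trunc_Ck0 s.
apply/CkSP; split=> [x Ox|i x Ox|i].
- by move/Ck0P : (CkM 0 Omega _ _ oO tC tC) => /(_ x Ox).
- exact: (@ex_derive _ _ _ _ _ _ _ (sqtrunc_is_derive s i x Ox)).
- apply: (Ck_eq_on _ _ (fun x => 2 * trunc s x * partial i u x) _ oO).
    by move=> x Ox; rewrite partial_sqtrunc.
  apply: (CkM _ _ _ _ oO); last exact/CkSW/partial_u_Ck1.
  by apply: (CkM _ _ _ _ oO (Ck_cst _ _ _)); exact: tC.
Qed.

Lemma sqtruncM_Ck1 s f : 0 < s -> Ck 1 Omega f ->
  Ck 1 setT (fun x => sqtrunc s x * f x).
Proof.
move=> s0 fO.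
apply: (Ck_zero_extension 1 Omega (superlevel s)).
- exact: oO.
- exact: superlevel_closed.
- exact: superlevel_sub.
- exact: (CkM _ _ _ _ oO (sqtrunc_Ck1_in s) fO).
- by move=> x /sqtrunc_out ->; rewrite mul0r.
Qed.

Lemma sqtruncM_cc s f : 0 < s -> Ck 0 Omega f ->
  cc (fun x => sqtrunc s x * f x).
Proof.
move=> s0 fO.
apply: (cc_zero_extension Omega (superlevel s)).
- exact: oO.
- exact: superlevel_bounded.
- exact: superlevel_closed.
- exact: superlevel_sub.
- exact: (CkM _ _ _ _ oO (CkSW _ _ _ (sqtrunc_Ck1_in s)) fO).
- by move=> x /sqtrunc_out ->; rewrite mul0r.
Qed.

Lemma sqtrunc_Ck1 s : 0 < s -> Ck 1 setT (sqtrunc s).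
Proof.
move=> s0; have := sqtruncM_Ck1 s _ s0 (Ck_cst 1 Omega 1).
by congr (Ck _ _ _); apply/funext => x; rewrite mulr1.
Qed.

Lemma sqtrunc_cc s : 0 < s -> cc (sqtrunc s).
Proof.
move=> s0; have := sqtruncM_cc s _ s0 (Ck_cst 0 Omega 1).
by congr cc; apply/funext => x; rewrite mulr1.
Qed.

Lemma integral_partial_sqtruncM s f i : 0 < s -> Ck 1 Omega f ->
  I (partial i (fun x => sqtrunc s x * f x)) = 0.
Proof.
move=> s0 f1; apply: integral_rV_Ck1_partial; last exact: sqtruncM_Ck1.
exact/sqtruncM_cc/CkSW.
Qed.

Lemma partial_sqtruncM_out s f i x : 0 < s -> ~ superlevel s x ->
  partial i (fun x => sqtrunc s x * f x) x = 0.
Proof.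
move=> s0 sx; rewrite (partial_eq_on (~` superlevel s) _ (fun=> 0)).
- exact: (derive_cst 0).
- exact/closed_openC/superlevel_closed.
- by move=> y /sqtrunc_out ->; rewrite mul0r.
- exact: sx.
Qed.

Lemma partial_sqtruncM_in s f i x : Ck 1 Omega f -> Omega x ->
  partial i (fun x => sqtrunc s x * f x) x =
  sqtrunc s x * partial i f x + f x * (2 * trunc s x * partial i u x).
Proof.
move=> /CkSP[_ df _] Ox; rewrite partialM ?partial_sqtrunc//; last exact: df.
exact: (@ex_derive _ _ _ _ _ _ _ (sqtrunc_is_derive s i x Ox)).
Qed.

Definition flux_coef (i j : 'I_N) (x : 'rV[R]_N) : R := V x * A x i j.

(** The vector field V A grad u, whose divergence is V L u (div_fluxE). *)
Definition flux (i : 'I_N) (x : 'rV[R]_N) : R :=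
  \sum_(j < N) flux_coef i j x * partial j u x.

Lemma flux_coef_smooth i j : smooth setT (flux_coef i j).
Proof. by move=> k; apply: CkM; [exact: openT|exact: V_smooth|exact: A_smooth]. Qed.

Lemma flux_term_Ck1 i j : Ck 1 Omega (fun x => flux_coef i j x * partial j u x).
Proof.
apply: (CkM _ _ _ _ oO); last exact: partial_u_Ck1.
by apply: Ck_sub (flux_coef_smooth i j 1).
Qed.

Lemma flux_Ck1 i : Ck 1 Omega (flux i).
Proof. by apply: Ck_sum => // j; exact: flux_term_Ck1. Qed.

Lemma div_fluxE x : Omega x ->
  \sum_(i < N) partial i (flux i) x = V x * Lop V A u x.
Proof.
move=> Ox; rewrite /Lop mulVKf ?gt_eqF//; apply: eq_bigr => i _.
apply: (@derive_val _ _ _ _ _ _ _ (partial_sum _ _ _ i x _)) => j.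
by have /CkSP[_ df _] := flux_term_Ck1 i j; exact: df.
Qed.

Definition gradu (x : 'rV[R]_N) : 'rV[R]_N := \row_j partial j u x.

Lemma fluxE i x : flux i x = V x * (gradu x *m A x) 0 i.
Proof.
rewrite mxE mulr_sumr; apply: eq_bigr => j _.
by rewrite /flux_coef -{1}(A_sym x) !mxE -mulrA [A x j i * _]mulrC.
Qed.

Lemma flux_grad x :
  \sum_(i < N) flux i x * partial i u x =
  V x * (gradu x *m A x *m (gradu x)^T) 0 0.
Proof.
rewrite [in RHS]mxE mulr_sumr; apply: eq_bigr => i _.
by rewrite fluxE -mulrA; congr (_ * (_ * _)); rewrite !mxE.
Qed.

(** The divergence of (u - s)_+^2 V A grad u, a field with compact support. *)
Definition energy (s : R) (x : 'rV[R]_N) : R :=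
  \sum_(i < N) partial i (fun y => sqtrunc s y * flux i y) x.

(** The product rule; the second term comes from the gradient of the
    truncation. *)
Lemma energyE s x : Omega x ->
  energy s x = sqtrunc s x * (V x * Lop V A u x) +
    2 * trunc s x * (V x * (gradu x *m A x *m (gradu x)^T) 0 0).
Proof.
move=> Ox; rewrite -div_fluxE// -flux_grad !mulr_sumr -big_split/=.
apply: eq_bigr => i _; rewrite partial_sqtruncM_in//; last exact: flux_Ck1.
by congr (_ + _); ring.
Qed.

Lemma sqtrunc_cu_ge0 s x : Omega x -> 0 < s -> 0 <= sqtrunc s x * (c x * u x).
Proof.
move=> Ox s0; have [ux|ux] := lerP s (u x).
  by rewrite mulr_ge0 ?sqr_ge0// mulr_ge0// (le_trans _ ux)// ltW.
rewrite sqtrunc_out ?mul0r// => -[_]; lra.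
Qed.

Lemma energy_ge0 s x : 0 < s -> 0 <= energy s x.
Proof.
move=> s0; have [Ox|nOx] := pselect (Omega x); last first.
  by rewrite /energy big1// => i _; apply: partial_sqtruncM_out => // -[/nOx].
rewrite energyE// addr_ge0//.
  rewrite mulrCA; apply: mulr_ge0; first exact: ltW.
  have := Lu_ge0 x Ox; rewrite /Lc subr_ge0 => cuL.
  by apply: le_trans (sqtrunc_cu_ge0 s x Ox s0) _; rewrite ler_wpM2l ?sqr_ge0.
have tx := trunc_ge0 s x; have Vx := ltW (V_gt0 x).
exact: mulr_ge0 (mulr_ge0 (ler0n _ 2) tx) (mulr_ge0 Vx (A_psd x _)).
Qed.

Lemma partial_sqtruncM_cc s f i : 0 < s -> Ck 1 Omega f ->
  cc (partial i (fun x => sqtrunc s x * f x)).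
Proof.
move=> s0 f1; apply: cc_partial; first exact/sqtruncM_cc/CkSW.
by have /CkSP[_ _ /(_ i) /Ck0P cF] := sqtruncM_Ck1 s f s0 f1 => x; exact: cF.
Qed.

(** A nonnegative continuous function with compact support whose integral
    vanishes, being a sum of integrals of partial derivatives. *)
Lemma energy_eq0 s x : 0 < s -> energy s x = 0.
Proof.
move=> s0; apply: integral_rV_eq0 x; [|by move=> x; exact: energy_ge0|].
  by apply: cc_sum => i; apply: partial_sqtruncM_cc => //; exact: flux_Ck1.
rewrite integral_rV_sum => [|i]; last first.
  by apply: partial_sqtruncM_cc => //; exact: flux_Ck1.
by rewrite big1// => i _; apply: integral_partial_sqtruncM => //; exact: flux_Ck1.
Qed.

(** Both nonnegative terms of the energy of the level s = u x / 2 vanish at x, and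
    x is a point where the truncation is positive. The first one then gives L u = 0,
    hence c u = 0; the second one gives A grad u = 0 by semi-definiteness. *)
Lemma degenerate_where_positive x : Omega x -> 0 < u x ->
  gradu x *m A x = 0 /\ c x = 0.
Proof.
move=> Ox ux; pose s := u x / 2; have s0 : 0 < s by rewrite divr_gt0.
have t0 : 0 < trunc s x.
  by rewrite truncE// (lt_le_trans _ (ge_pos _))// /s; lra.
have w0 : 0 < sqtrunc s x by rewrite exprn_gt0.
have Vx := V_gt0 x; have cx := c_ge0 x.
have q0 := A_psd x (gradu x).
have := Lu_ge0 x Ox; rewrite /Lc subr_ge0 => cuL.
have cu0 : 0 <= c x * u x by rewrite mulr_ge0// ltW.
have L0 : 0 <= Lop V A u x by exact: le_trans cuL.
have /eqP := energy_eq0 s x s0; rewrite energyE// paddr_eq0; last 2 first.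
- exact: mulr_ge0 (ltW w0) (mulr_ge0 (ltW Vx) L0).
- exact: mulr_ge0 (mulr_ge0 (ler0n _ 2) (ltW t0)) (mulr_ge0 (ltW Vx) q0).
have t20 : 0 < 2 * trunc s x by rewrite mulr_gt0.
have pmul0 (a b : R) : 0 < a -> (a * b == 0) = (b == 0).
  by move=> a0; rewrite mulf_eq0 gt_eqF.
rewrite (pmul0 _ _ w0) (pmul0 _ _ Vx) (pmul0 _ _ t20) (pmul0 _ _ Vx).
move=> /andP[/eqP Lx /eqP qx].
split; first exact: psd_isotropic.
have : c x * u x == 0 by rewrite eq_le cu0 -Lx cuL.
by rewrite mulf_eq0 (gt_eqF ux) orbF => /eqP.
Qed.

Lemma sqtrunc_c0 s x : 0 < s -> c x * sqtrunc s x = 0.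
Proof.
move=> s0; have [sx|sx] := pselect (superlevel s x); last first.
  by rewrite sqtrunc_out ?mulr0.
have [Ox us] := sx; have [|_ ->] := degenerate_where_positive x Ox.
  exact: lt_le_trans s0 us.
by rewrite mul0r.
Qed.

Lemma flux_partial_sqtrunc i s x : 0 < s ->
  \sum_(j < N) flux_coef i j x * partial j (sqtrunc s) x = 0.
Proof.
move=> s0; have [sx|sx] := pselect (superlevel s x).
  have [Ox us] := sx; have [|gA _] := degenerate_where_positive x Ox.
    exact: lt_le_trans s0 us.
  transitivity (2 * trunc s x * flux i x).
    rewrite mulr_sumr; apply: eq_bigr => j _; rewrite partial_sqtrunc//; ring.
  by rewrite fluxE gA mxE !mulr0.
rewrite big1// => j _.
rewrite (partial_eq_on (~` superlevel s) _ (fun=> 0)); first last.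
- exact: sx.
- by move=> y /sqtrunc_out.
- exact/closed_openC/superlevel_closed.
by rewrite [partial _ _ _](derive_cst 0) mulr0.
Qed.

(** The distribution dist_Lc pairs the truncation w with
    sum_ij d_j (V A_ij d_i psi), psi = phi / V. One integration by parts turns this
    into minus the integral of sum_i d_i psi (sum_j V A_ij d_j w), and V A grad w = 0. *)
Lemma dist_Lc_sqtrunc s phi : 0 < s -> test_function setT phi ->
  dist_Lc V A c (dist_of (sqtrunc s)) phi = 0.
Proof.
move=> s0 tphi; have [sphi _ _] := tphi.
pose psi x := (V x)^-1 * phi x.
have psi2 : Ck 2 setT psi.
  apply: CkM; [exact: openT| |exact: sphi].
  by apply: CkV; [exact: openT|move=> x _; rewrite gt_eqF|exact: V_smooth].
pose b i j x := flux_coef i j x * partial i psi x.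
have b1 i j : Ck 1 setT (b i j).
  apply: CkM; [exact: openT|exact: flux_coef_smooth|].
  by move: psi2 => /CkSP[_ _].
have sq1 := sqtrunc_Ck1 s s0; have ccs := sqtrunc_cc s s0.
have ccbs i j : cc (fun x => b i j x * partial j (sqtrunc s) x).
  apply: ccMl; first by move=> x; move/CkSW/Ck0P : (b1 i j); exact.
  apply: cc_partial => //; move: sq1 => /CkSP[_ _ /(_ j) /Ck0P cs] x; exact: cs.
rewrite /dist_Lc /dist_mul /dist_of; have -> : integral_rV
    (fun x => sqtrunc s x * (c x * phi x)) = 0.
  rewrite -[RHS](@integral_rV0 R N); congr integral_rV; apply/funext => x.
  by rewrite mulrA [_ * c x]mulrC sqtrunc_c0// mul0r.
have ibp i j : I (fun x => sqtrunc s x * partial j (b i j) x) =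
    - I (fun x => b i j x * partial j (sqtrunc s) x).
  have bOmega : Ck 1 Omega (b i j) by apply: Ck_sub (b1 i j).
  apply/eqP; rewrite -addr_eq0 -integral_rVD//; last first.
    by apply: sqtruncM_cc => //; move: bOmega => /CkSP[_ _].
  rewrite -(integral_partial_sqtruncM s (b i j) j s0 bOmega); apply/eqP.
  congr integral_rV; apply/funext => x; rewrite partialM//.
    by move: sq1 => /CkSP[_ dsq _]; exact: dsq.
  by move: (b1 i j) => /CkSP[_ db _]; exact: db.
have sum0 : \sum_(i < N) \sum_(j < N)
    I (fun x => b i j x * partial j (sqtrunc s) x) = 0.
  transitivity (I (fun x => \sum_(i < N) \sum_(j < N)
      b i j x * partial j (sqtrunc s) x)).
    rewrite integral_rV_sum => [|i]; last exact: cc_sum.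
    by apply: eq_bigr => i _; rewrite integral_rV_sum.
  rewrite -[RHS](@integral_rV0 R N); congr integral_rV; apply/funext => x.
  rewrite big1// => i _.
  transitivity (partial i psi x *
      \sum_(j < N) flux_coef i j x * partial j (sqtrunc s) x).
    by rewrite mulr_sumr; apply: eq_bigr => j _; rewrite /b; ring.
  by rewrite flux_partial_sqtrunc// mulr0.
transitivity (- \sum_(i < N) \sum_(j < N)
    I (fun x => b i j x * partial j (sqtrunc s) x)); last by rewrite sum0 oppr0.
rewrite subr0 /dist_Lop /dist_mul /dist_partial -sumrN.
apply: eq_bigr => i _; rewrite -sumrN; apply: eq_bigr => j _.
by rewrite opprK; exact: ibp.
Qed.

End truncated_subsolution.

(** * Hypoellipticity and the sign of a subsolution *)

Section regular_distributions.
Context {R : realType} {N : nat}.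
Implicit Types f phi : 'rV[R]_N -> R.
Notation I f := (integral_rV f).

Lemma norm_le_Ck_norm0 phi x : cc phi -> `|phi x| <= Ck_norm 0 phi.
Proof.
move=> /cc_bounded[M M0 phiM]; apply: ub_le_sup; last by exists [::] => //; exists x.
by exists M => _ [s /= + [y _ <-]]; rewrite leqn0 size_eq0 => /eqP ->; exact: phiM.
Qed.

(** A distribution of order zero: the supremum of |phi| controls the pairing. *)
Lemma distribution_dist_of f : cc f -> distribution_on setT (dist_of f).
Proof.
move=> ccf; have [cf [L fL]] := ccf; split=> [a phi psi tphi tpsi|K _ _].
  have ccM phi' : test_function setT phi' -> cc (fun x => f x * phi' x).
    by move=> /test_function_cc; exact: ccMl.
  rewrite /dist_of -integral_rVZD; [|exact: ccM|exact: ccM].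
  by congr integral_rV; apply/funext => x; ring.
have [M M0 fM] := cc_bounded f ccf.
exists 0, (M * (2 * `|L|) ^+ N) => phi tphi _.
have ccphi := test_function_cc _ _ tphi.
rewrite mulrAC; apply: norm_integral_rV_le => //; first exact: ccMl.
  by move=> x Lx; rewrite fL ?mul0r// (le_lt_trans (ler_norm L)).
move=> x; rewrite normrM ler_pM//; exact: norm_le_Ck_norm0.
Qed.

End regular_distributions.

Section max_principle.
Context {R : realType} {N : nat}.
Variables (V : 'rV[R]_N -> R) (A : 'rV[R]_N -> 'M[R]_N) (c : 'rV[R]_N -> R).
Hypotheses (V_smooth : smooth setT V) (V_gt0 : forall x, 0 < V x).
Hypothesis A_smooth : forall i j : 'I_N, smooth setT (fun x => A x i j).
Hypothesis A_sym : forall x, (A x)^T = A x.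
Hypothesis A_psd : forall x (v : 'rV[R]_N), 0 <= (v *m A x *m v^T) 0 0.
Hypothesis c_ge0 : forall x, 0 <= c x.
Hypothesis Lc_hypo : hypoelliptic (dist_Lc V A c) setT.
Variables (Omega : set 'rV[R]_N) (u : 'rV[R]_N -> R).
Hypotheses (oO : open Omega) (bO : bounded_set Omega) (u2 : Ck 2 Omega u).
Hypothesis Lu_ge0 : forall x, Omega x -> 0 <= Lc V A c u x.
Hypothesis superlevel_closed : forall s, 0 < s -> closed (superlevel Omega u s).

Notation I f := (integral_rV f).
Notation w := (sqtrunc Omega u).

(** Hypoellipticity, applied with right-hand side 0, gives a smooth g that defines
    the same distribution as the truncation; two continuous functions with this
    property coincide. *)
Lemma sqtrunc_smooth s : 0 < s -> smooth setT (w s).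
Proof.
move=> s0; have ccw : cc (w s) by exact: sqtrunc_cc.
have [||g [gs gw]] := Lc_hypo _ (distribution_dist_of _ ccw) setT openT
    (@subset_refl _ _) (fun=> 0).
- by move=> k; exact: Ck_cst.
- move=> phi tphi; rewrite (dist_Lc_sqtrunc V A c) // /dist_of.
  rewrite -[LHS](@integral_rV0 R N); congr integral_rV.
  by apply/funext => x; rewrite mul0r.
suff -> : w s = g by [].
apply/funext => x; apply/eqP; rewrite -subr_eq0; apply/eqP; move: x.
have cg := smooth_continuous _ gs.
apply: fundamental_lemma => [x|phi tphi].
  by apply: continuousB; [exact: ccw.1|exact: cg].
have ccphi := test_function_cc _ _ tphi.
have := gw phi tphi; rewrite /dist_of => /eqP; rewrite -subr_eq0 -integral_rVB.
- move=> /eqP <-; congr integral_rV; apply/funext => x; rewrite -mulrBl//.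
- by apply: ccMl => //; exact: ccw.1.
- exact: ccMl.
Qed.

(** The mean value theorem on a line in direction e_i, from x to a point outside
    the support of the truncation at the level u x / 2. *)
Lemma exists_noncritical (i : 'I_N) x : Omega x -> 0 < u x ->
  exists y, [/\ Omega y, 0 < u y & partial i u y != 0].
Proof.
move=> Ox ux; pose s := u x / 2; have s0 : 0 < s by rewrite divr_gt0.
have ccw : cc (w s) by exact: sqtrunc_cc.
have w1 : Ck 1 setT (w s) by exact: sqtrunc_Ck1.
have dw y : derivable (w s) y (delta_mx 0 i).
  by move: w1 => /CkSP[_ dw _]; exact: dw.
have [_ [L wL]] := ccw.
(* The point h e_i + x has norm greater than L. *)
pose h := `|L| + `|x| + 1.
have h0 : 0 < h by rewrite ltr_wpDl// addr_ge0.
have [t _] := MVT_line (w s) x (delta_mx 0 i) h h0 dw.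
rewrite wL; last first.
  have := lerB_dist (h *: delta_mx 0 i : 'rV[R]_N) (- x).
  have : h <= `|h *: delta_mx 0 i : 'rV[R]_N|.
    by have := rV_coord_le (h *: delta_mx 0 i) i; rewrite !mxE !eqxx mulr1 gtr0_norm.
  rewrite normrN opprK /h; have := ler_norm L; lra.
have wx : 0 < w s x.
  by rewrite exprn_gt0// truncE// (lt_le_trans _ (ge_pos _))// /s; lra.
set y := t *: delta_mx 0 i + x => wy.
have Dwy : partial i (w s) y != 0.
  by apply/eqP => D0; move: wy; rewrite -[derive _ _ _]/(partial i (w s) y) D0; lra.
have [sy|sy] := pselect (superlevel Omega u s y).
  exists y; have [Oy us] := sy; split=> //; first exact: lt_le_trans us.
  apply: contraNN Dwy => /eqP D0.
  by rewrite (partial_sqtrunc Omega u oO u2)// D0 mulr0.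
case/eqP: Dwy; rewrite (partial_eq_on (~` superlevel Omega u s) _ (fun=> 0)).
- exact: (derive_cst 0).
- exact/closed_openC/superlevel_closed.
- by move=> z /sqtrunc_out ->.
- exact: sy.
Qed.

(** Truncate at the level s = u x. If d_i u x <> 0, dividing d_i w by 2 d_i u shows
    that (u - s)_+ is differentiable at x in direction e_i. Both (u - s)_+ and
    (u - s)_+ - u have a local minimum at x, so both have derivative zero there, and
    so has u: a contradiction. *)
Lemma smooth_truncation_critical (i : 'I_N) x : Omega x -> 0 < u x ->
  partial i u x = 0.
Proof.
move=> Ox ux; apply/eqP/negPn/negP => dux.
set s := u x; set e := delta_mx 0 i : 'rV[R]_N.
have oxO := open_nbhs_nbhs (conj oO Ox).
have /CkSP[cdu ddu _] := partial_u_Ck1 Omega u u2 i.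
have dpos : derivable (trunc Omega u s) x e.
  have ww : derivable (partial i (w s)) x e.
    have /CkSP[_ _ /(_ i)/CkSP[_ dw _]] := sqtrunc_smooth s ux 2.
    exact: dw.
  apply: (near_eq_derivable _ (derivableM ww (derivableM
    (derivable_cst (2^-1 : R) x e) (derivableV dux (ddu i x Ox))))).
  have du_near : \forall y \near x, partial i u y != 0.
    exact: cvgr_neq0 (cdu x Ox) dux.
  apply: filterS2 oxO du_near => y Oy duy.
  rewrite !fctE (partial_sqtrunc Omega u oO u2)//; field; exact: duy.
have tx0 : trunc Omega u s x = 0 by rewrite truncE// subrr pos_eq0.
have D1 : 'D_e (trunc Omega u s) x = 0.
  apply: derive_local_min => //; near=> y; rewrite tx0; exact: trunc_ge0.
have du := u_derivable Omega u u2 i x Ox.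
have D2 : 'D_e (trunc Omega u s - u) x = 0.
  apply: derive_local_min; first exact: derivableB.
  apply: filterS oxO => y Oy; rewrite !fctE tx0 truncE//.
  by have := ge_pos (u y - s); rewrite -/s; lra.
move: D2; rewrite deriveB// D1 sub0r => /eqP; rewrite oppr_eq0; exact/negP.
Unshelve. all: by end_near. Qed.

Lemma subsolution_le0 (i : 'I_N) x : Omega x -> u x <= 0.
Proof.
move=> Ox; rewrite leNgt; apply/negP => ux.
have [y [Oy uy /eqP]] := exists_noncritical i x Ox ux.
by apply; exact: smooth_truncation_critical.
Qed.

End max_principle.

(** * Boundary behaviour and the maximum principles *)

Section boundary_behaviour.
Context {R : realType} {N : nat}.
Implicit Types (Omega : set 'rV[R]_N) (u : 'rV[R]_N -> R).

Lemma limf_esup_le0P (F : set_system 'rV[R]_N) u : Filter F ->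
  (limf_esup (fun x => (u x)%:E) F <= 0)%E <->
  forall e, 0 < e -> \forall x \near F, u x <= e.
Proof.
move=> FF; split=> [ul e e0|ue].
  have : (limf_esup (fun x => (u x)%:E) F < e%:E)%E.
    by apply: le_lt_trans ul _; rewrite lte_fin.
  move=> /ereal_inf_lt[_ [W FW <-] We]; apply: filterS FW => x Wx.
  rewrite -lee_fin; apply: le_trans (ltW We).
  by apply: ereal_sup_ubound; exists x.
apply/lee_addgt0Pr => e e0; rewrite add0e.
apply: ereal_inf_le; exists (ereal_sup ((fun x => (u x)%:E) @` [set x | u x <= e])).
  by exists [set x | u x <= e] => //; exact: ue.
by apply: ge_ereal_sup => _ [x /= xe <-]; rewrite lee_fin.
Qed.

(** A limit point of {u >= s} that is not in Omega would be a boundary point at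
    which the limsup of u is at least s. *)
Lemma superlevel_closed_of_limsup Omega u : open Omega ->
  (forall x, Omega x -> {for x, continuous u}) ->
  (forall x0, boundary Omega x0 ->
    (limf_esup (fun x => (u x)%:E) (within Omega (nbhs x0)) <= 0)%E) ->
  forall s, 0 < s -> closed (superlevel Omega u s).
Proof.
move=> oO cu ubd s s0 x clx.
have cK (P : set 'rV[R]_N) : nbhs x P -> exists y, [/\ Omega y, s <= u y & P y].
  by move=> /clx[y [[Oy sy] Py]]; exists y.
have [Ox|nOx] := pselect (Omega x).
  split=> //; rewrite leNgt; apply/negP => uxs.
  have /cK[y [_ sy]] : nbhs x [set y | u y < s] by exact: cvgr_lt (cu x Ox) _ uxs.
  by rewrite /= ltNge sy.
have bx : boundary Omega x.
  split; last exact: subset_closure.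
  by move=> P /cK[y [Oy _ Py]]; exists y.
have s20 : 0 < s / 2 by rewrite divr_gt0.
have [y [Oy sy /(_ Oy)]] := cK _ ((limf_esup_le0P _ u _).1 (ubd x bx) _ s20).
by rewrite /=; lra.
Qed.

(** Follow the line through x in direction e_i up to the supremum of the
    parameters whose point belongs to Omega. *)
Lemma boundary_nonempty Omega x (i : 'I_N) : bounded_set Omega -> Omega x ->
  boundary Omega !=set0.
Proof.
move=> [M [_ OM]] Ox; pose e := delta_mx 0 i : 'rV[R]_N.
pose S := [set t : R | Omega (t *: e + x)].
have S0 : S 0 by rewrite /S/= scale0r add0r.
have eN t : `|t| = `|t *: e|.
  apply/eqP; rewrite eq_le; apply/andP; split.
    by have := rV_coord_le (t *: e) i; rewrite !mxE !eqxx mulr1.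
  by rewrite normrZ ler_piMr ?norm_delta_le.
have supS : has_sup S.
  split; first by exists 0.
  exists (`|M| + 1 + `|x|) => t St.
  have : `|t *: e + x| <= `|M| + 1.
    by apply: OM St; rewrite (le_lt_trans (ler_norm M))// ltrDl.
  have := lerB_dist (t *: e) (- x); rewrite normrN opprK -eN.
  have := ler_norm t; lra.
set t := sup S; exists (t *: e + x).
have near_t (r : R) (P : set 'rV[R]_N) : 0 < r ->
    ball (t *: e + x) r `<=` P -> forall t', `|t - t'| < r -> P (t' *: e + x).
  move=> r0 rP t' tt'; apply: rP; rewrite -ball_normE/=.
  by rewrite opprD addrACA subrr addr0 -scalerBl -eN.
split=> P /nbhs_ballP[r /= r0 rP].
  have [t' St' tt'] := sup_adherent r0 supS.
  exists (t' *: e + x); split=> //; apply: (near_t r P r0 rP).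
  have : t' <= t := ub_le_sup supS.2 St'.
  by rewrite -/t in tt' => t't; rewrite ger0_norm ?subr_ge0//; lra.
exists ((t + r / 2) *: e + x); split; last first.
  by apply: (near_t r P r0 rP); rewrite opprD addNKr normrN gtr0_norm ?divr_gt0//; lra.
move=> St; have : t + r / 2 <= t := ub_le_sup supS.2 St.
by apply/negP; rewrite -ltNge ltrDl divr_gt0.
Qed.

End boundary_behaviour.

Section subtract_constant.
Context {R : realType} {N : nat}.
Variables (V : 'rV[R]_N -> R) (A : 'rV[R]_N -> 'M[R]_N) (c : 'rV[R]_N -> R).
Implicit Type u : 'rV[R]_N -> R.

Lemma partialB_cst i u m : partial i (fun x => u x - m) = partial i u.
Proof.
apply/funext => x; rewrite /partial /derive.
pose quotient (f : 'rV[R]_N -> R) (h : R) :=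
  h^-1 *: ((f \o shift x) (h *: delta_mx 0 i) - f x).
rewrite -/(quotient (fun x => u x - m)) -/(quotient u).
suff -> : quotient (fun x => u x - m) = quotient u by [].
by apply/funext => h; rewrite /quotient/= opprB addrA subrK.
Qed.

Lemma LcB_cst u m x : Lc V A c (fun x => u x - m) x = Lc V A c u x + c x * m.
Proof.
have LopE : Lop V A (fun y => u y - m) x = Lop V A u x.
  congr (_ * _); apply: eq_bigr => i _; apply: eq_bigr => j _.
  by rewrite partialB_cst.
rewrite /Lc LopE.
by rewrite mulrBr opprB [c x * m - _]addrC addrA.
Qed.

End subtract_constant.

Theorem mainTheorem9 (R : realType) (N : nat)
    (V : 'rV[R]_N -> R) (A : 'rV[R]_N -> 'M[R]_N) (c : 'rV[R]_N -> R)
    (V_smooth : smooth setT V) (V_gt0 : forall x, 0 < V x)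
    (A_smooth : forall i j : 'I_N, smooth setT (fun x => A x i j))
    (A_sym : forall x, (A x)^T = A x)
    (A_psd : forall x (v : 'rV[R]_N), 0 <= (v *m A x *m v^T) 0 0)
    (A_neq0 : forall x, A x <> 0)
    (c_smooth : smooth setT c) (c_ge0 : forall x, 0 <= c x)
    (Lc_hypo : forall Omega : set 'rV[R]_N, open Omega ->
       hypoelliptic (dist_Lc V A c) Omega) :
  (forall Omega : set 'rV[R]_N, open Omega -> bounded_set Omega ->
     weak_max_principle (Lc V A c) Omega)
  /\
  (forall Omega : set 'rV[R]_N, open Omega -> bounded_set Omega ->
     forall u : 'rV[R]_N -> R,
       Ck 2 Omega u ->
       {within closure Omega, continuous u} ->
       (forall x, closure Omega x -> 0 <= u x) ->
       (forall x, Omega x -> 0 <= Lc V A c u x) ->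
       ereal_sup [set (u x)%:E | x in closure Omega]
       = ereal_sup [set (u x)%:E | x in boundary Omega]).
Proof.
(* In dimension 0 the only matrix is 0, which A_neq0 excludes. *)
have i : 'I_N.
  case: N V A c A_neq0 {V_smooth V_gt0 A_smooth A_sym A_psd c_smooth c_ge0 Lc_hypo}
    => [|n] V' A' c' A'0; last exact: ord0.
  by case: (A'0 0); apply/matrixP => -[].
have wmp Omega : open Omega -> bounded_set Omega ->
    weak_max_principle (Lc V A c) Omega.
  move=> oO bO u u2 Lu ubd x; apply: (subsolution_le0 V A c) => //.
    exact: Lc_hypo openT.
  apply: superlevel_closed_of_limsup ubd => // y Oy.
  by move: u2 => /CkSP[cu _ _]; exact: cu.
split=> // Omega oO bO u u2 cu u0 Lu.
have bnd_sub : boundary Omega `<=` closure Omega by move=> x [].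
apply/eqP; rewrite eq_le; apply/andP; split; last first.
  by apply: le_ereal_sup => _ [x bx <-]; exists x => //; exact: bnd_sub.
set B := ereal_sup [set (u x)%:E | x in boundary Omega].
have uB x : boundary Omega x -> ((u x)%:E <= B)%E.
  by move=> bx; apply: ereal_sup_ubound; exists x.
apply: ge_ereal_sup => _ [x clx <-].
have [Ox|nOx] := pselect (Omega x); last first.
  by apply: uB; split=> //; exact: subset_closure.
have [z bz] := boundary_nonempty Omega x i bO Ox.
have B0 : (0 <= B)%E by apply: le_trans (uB z bz); rewrite lee_fin (u0 z (bnd_sub z bz)).
case BE : B B0 uB => [m| |] //; rewrite ?leey// lee_fin => m0 uB.
rewrite lee_fin -subr_le0; apply: (wmp Omega oO bO (fun y => u y - m)) Ox.
- apply: (CkD _ _ u (fun=> - m) oO u2); exact: Ck_cst.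
- by move=> y Oy; rewrite LcB_cst addr_ge0 ?Lu// mulr_ge0.
move=> x0 bx0; apply/limf_esup_le0P => e e0.
have /subspace_continuousP /(_ x0 (bnd_sub x0 bx0)) /cvgr_le := cu.
move=> /(_ (u x0 + e)); rewrite ltrDl => /(_ e0).
rewrite !near_withinE; apply: filterS => y + /subset_closure cly => /(_ cly).
move=> uy; rewrite lerBlDr; apply: le_trans uy _.
by rewrite addrC lerD2l -lee_fin uB.
Qed.
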